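(* Let $F_n, F \colon [0,+\infty)^2 \to [0,+\infty)$, $n=1,2,\dots$, be continuous metric preserving functions (i.e. $F_n, F \in \mathcal{F}^2$) such that $F_n \to F$ pointwise as $n\to\infty$. Then the following two conditions are equivalent: (1) For any two sequences $\{X_n\}_{n\in\mathbb N}$ and $\{Y_n\}_{n\in\mathbb N}$ of mm-spaces concentrating to mm-spaces $X$ and $Y$ respectively, the sequence $\{X_n \times_{F_n} Y_n\}_{n\in\mathbb N}$ concentrates to $X \times_F Y$ as $n\to\infty$. (2) For every $s,t \in [0,+\infty)$, $$\lim_{n\to\infty}\Big(F_n(s,t) - \inf_{s\le s',\ t\le t'} F_n(s',t')\Big) = 0.$$
   Context: An mm-space is a triple $(X,d_X,m_X)$ where $(X,d_X)$ is a complete separable metric space and $m_X$ is a Borel probability measure on $X$; two mm-spaces are identified if there is an isometry between the supports of their measures pushing one measure to the other (mm-isomorphism). A function $F\colon[0,+\infty)^N\to[0,+\infty)$ is a metric preserving function if for any metric spaces $(X_1,d_1),\dots,(X_N,d_N)$ the function $d_F((x_i)_{i},(x'_i)_{i}) := F(d_1(x_1,x'_1),\dots,d_N(x_N,x'_N))$ is a metric on $X_1\times\cdots\times X_N$. $\mathcal F^N$ denotes the set of continuous metric preserving functions on $[0,+\infty)^N$. For $F\in\mathcal F^2$ and mm-spaces $X,Y$, the product space is the mm-space $X\times_F Y := (X\times Y, d_F, m_X\otimes m_Y)$. Concentration: Let $I=[0,1)$ with Lebesgue measure $\mathcal L^1$. A parameter of an mm-space $X$ is a Borel map $\varphi\colon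 I\to X$ with $\varphi_*\mathcal L^1 = m_X$ (every mm-space has one). For measurable $f,g\colon I\to\mathbb R$, the Ky Fan metric is $\mathrm{me}(f,g):=\inf\{\varepsilon\ge 0 : \mathcal L^1(\{|f-g|>\varepsilon\})\le\varepsilon\}$. Writing $\mathrm{Lip}_1(X)$ for the set of real 1-Lipschitz functions on $X$ and $\varphi^*\mathrm{Lip}_1(X)=\{f\circ\varphi : f\in\mathrm{Lip}_1(X)\}$, the observable distance is $d_{\mathrm{conc}}(X,Y) := \inf_{\varphi,\psi} d_H(\varphi^*\mathrm{Lip}_1(X),\psi^*\mathrm{Lip}_1(Y))$, where $\varphi,\psi$ range over parameters of $X,Y$ and $d_H$ is the Hausdorff distance with respect to the Ky Fan metric. A sequence $\{X_n\}$ concentrates to $X$ if $d_{\mathrm{conc}}(X_n,X)\to 0$. *)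

(* Defs.v *)
From HB Require Import structures.
From mathcomp Require Import all_boot all_order all_algebra.
From mathcomp Require Import all_classical all_reals all_analysis.
Set Implicit Arguments. Unset Strict Implicit. Unset Printing Implicit Defensive.
Import Order.TTheory GRing.Theory Num.Theory.
Import numFieldNormedType.Exports.
Local Open Scope classical_set_scope.
Local Open Scope ring_scope.

Section Defs.
Variable R : realType.

Definition is_metric (T : Type) (d : T -> T -> R) : Prop :=
  (forall x y, 0 <= d x y) /\ (forall x y, d x y = 0 <-> x = y) /\
  (forall x y, d x y = d y x) /\ (forall x y z, d x z <= d x y + d y z).

Definition metric_complete (T : Type) (d : T -> T -> R) : Prop :=
  forall u : nat -> T,
    (forall e, 0 < e -> exists N, forall m n, (N <= m)%N -> (N <= n)%N -> d (u m) (u n) < e) ->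
    exists x, forall e, 0 < e -> exists N, forall n, (N <= n)%N -> d (u n) x < e.

Definition metric_separable (T : Type) (d : T -> T -> R) : Prop :=
  exists u : nat -> T, forall x e, 0 < e -> exists n, d x (u n) < e.

Definition metric_open (T : Type) (d : T -> T -> R) : set (set T) :=
  [set A | forall x, A x -> exists e, 0 < e /\ (forall y, d x y < e -> A y)].

Definition borel_d (T : Type) (d : T -> T -> R) : set (set T) := <<s metric_open d >>.

Definition metric_preserving2 (F : R -> R -> R) : Prop :=
  forall (T1 T2 : Type) (d1 : T1 -> T1 -> R) (d2 : T2 -> T2 -> R),
    is_metric d1 -> is_metric d2 ->
    is_metric (fun p q : T1 * T2 => F (d1 p.1 q.1) (d2 p.2 q.2)).

Definition in_F2 (F : R -> R -> R) : Prop :=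
  metric_preserving2 F /\
  {within [set p : R * R | 0 <= p.1 /\ 0 <= p.2], continuous (fun p : R * R => F p.1 p.2)}.

Record mmdata := MMData {
  md_T : Type;
  md_d : md_T -> md_T -> R;
  md_mu : set md_T -> \bar R }.
Arguments md_d : clear implicits.
Arguments md_mu : clear implicits.

Record mmspace := MMSpace {
  mm_T : pointedType;
  mm_d : mm_T -> mm_T -> R;
  mm_metric : is_metric mm_d;
  mm_complete : metric_complete mm_d;
  mm_separable : metric_separable mm_d;
  mm_P : probability (g_sigma_algebraType (metric_open mm_d)) R }.
Arguments mm_d : clear implicits.

Definition mm_data (X : mmspace) : mmdata :=
  @MMData (mm_T X) (mm_d X) (mm_P X : set (mm_T X) -> \bar R).
Coercion mm_data : mmspace >-> mmdata.

Definition mmprod (F : R -> R -> R) (X Y : mmspace) : mmdata :=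
  @MMData (mm_T X * mm_T Y)%type
    (fun p q => F (mm_d X p.1 q.1) (mm_d Y p.2 q.2))
    (((mm_P X : set (g_sigma_algebraType (metric_open (mm_d X))) -> \bar R) \x
      (mm_P Y : set (g_sigma_algebraType (metric_open (mm_d Y))) -> \bar R))%E
      : set (mm_T X * mm_T Y) -> \bar R).

Definition I01 : set R := `[0, 1[%classic.

(* phi : I -> X is Borel and phi_* L^1 = m_X (phi is given on R, only I matters) *)
Definition parameter (X : mmdata) (phi : R -> md_T X) : Prop :=
  forall B, borel_d (md_d X) B ->
    measurable (I01 `&` phi @^-1` B) /\
    (lebesgue_measure (I01 `&` phi @^-1` B) = md_mu X B)%E.

Definition Lip1 (X : mmdata) : set (md_T X -> R) :=
  [set f | forall x y, `|f x - f y| <= md_d X x y].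

Definition pullback_Lip1 (X : mmdata) (phi : R -> md_T X) : set (R -> R) :=
  [set f \o phi | f in @Lip1 X].

Definition kyfan (f g : R -> R) : R :=
  inf [set e : R | 0 <= e /\
         (lebesgue_measure (I01 `&` [set x | (e < `|f x - g x|)%R]) <= e%:E)%E].

Definition hausdorff_kyfan (A B : set (R -> R)) : R :=
  Num.max (sup [set inf [set kyfan a b | b in B] | a in A])
          (sup [set inf [set kyfan a b | a in A] | b in B]).

Definition dconc (X Y : mmdata) : R :=
  inf [set r : R | exists (phi : R -> md_T X) (psi : R -> md_T Y),
        parameter phi /\ parameter psi /\
        r = hausdorff_kyfan (pullback_Lip1 phi) (pullback_Lip1 psi)].

Definition concentrates (Xs : nat -> mmdata) (X : mmdata) : Prop :=
  (fun n => dconc (Xs n) X) @ \oo --> (0 : R).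

End Defs.

(* Main.v *)
(* Sufficiency.  If the pull-backs of [Lip_1(X_n)] and [Lip_1(X)] by parameters
   [phi_n], [psi_n] are close, then testing with distances to finitely many
   points shows that [psi_n] does not increase distances seen through [phi_n],
   up to a small error and off a small set; testing with distances to a set [U]
   shows that any two non-negligible subsets of two small balls of [X] contain
   points whose [X_n]-distance is almost the distance of the centers.  By Fubini
   the latter passes to products, so a 1-Lipschitz function on [X_n x Y_n] is,
   off a small set, almost 1-Lipschitz for [d_F] when read on [X x Y], and is
   corrected by McShane's extension.  The converse direction uses the former
   fact and the condition on [F_n], which lets the arguments of [F_n] grow.
   Product parameters exist because [0, 1) carries a parameter of its square.

   Necessity.  If [F_n(s_n, t_n) <= F_n(s, t) - e] with [s_n > s], [t_n > t] for
   infinitely many [n], let [X_n] be two discrete cubes at distance [s] whose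
   diameter is [s_n - s] and whose dimension is so large that [X_n] concentrates
   to two points at distance [s]; similarly for [Y_n].  The antipodal map of
   [X_n x Y_n] preserves the measure, exchanges opposite clusters and moves all
   points by [F_n(s_n, t_n)], so Lipschitz functions on [X_n x Y_n] cannot
   separate opposite clusters by [F(s, t)]. *)
From HB Require Import structures.
From mathcomp Require Import all_boot all_order all_algebra.
From mathcomp Require Import all_classical all_reals all_analysis.
From mathcomp Require Import measurable_realfun.
From mathcomp Require Import ring lra zify.
Require Import Defs.
Set Implicit Arguments. Unset Strict Implicit. Unset Printing Implicit Defensive.
Import Order.TTheory GRing.Theory Num.Theory.
Import numFieldNormedType.Exports.
Local Open Scope classical_set_scope.
Local Open Scope ring_scope.

(** For an upper bound on [dconc] of two products it is enough to use product parameters. Necessity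
    meets the opposite problem: the parameters supplied by convergence of the products are arbitrary
    and need not respect the clusters. The remedy is to sum over all pairs of points. Distance
    functions of the four-point limit are approximated by functions that are 1-Lipschitz for some
    [D], equal to [d_F] except on opposite pairs, where it is smaller. Whatever the coupling of the
    two uniform laws on four points, averaging over two independent parameter values bounds the sum
    of [d_F] by the sum of [D] up to a small error, which is absurd.

    In sufficiency, Fubini only finds points inside non-negligible sets. A point is therefore traded
    for a set of positive mass in its cell, on which the function is at most, or at least, its value
    there up to a small error; points of extreme value are discarded. Errors in the arguments of a
    metric preserving function [F] are controlled by [F r r] with [r] small, so pointwise
    convergence is used at finitely many arguments only. *)

Lemma countable_bigcup_measurable d (T : measurableType d) (I : countType)
    (D : set I) (A : I -> set T) :
  (forall i, D i -> measurable (A i)) -> measurable (\bigcup_(i in D) A i).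
Proof.
move=> mA; rewrite bigcup_mkcond; apply: countable_bigcupT_measurable.
  exact: countableP.
by move=> i; case: ifPn => // /set_mem /mA.
Qed.

(** * Parameters of Polish probability spaces *)

Section Lambda.
Variable R : realType.

Lemma measurable_I01 : measurable (@I01 R).
Proof. exact: measurable_itv. Qed.

(** [lebesgue_measure] is defined on all sets and stays monotone and subadditive there ([le_lam],
    [lamU2]), so Ky Fan estimates can be made before anything is known about measurability of the
    exceptional sets. *)
Definition lam (A : set R) : \bar R := lebesgue_measure (@I01 R `&` A).

Let lam0 : lam set0 = 0%E. Proof. by rewrite /lam setI0 measure0. Qed.

Let lam_ge0 A : (0 <= lam A)%E. Proof. exact: measure_ge0. Qed.

Let lam_sigma_additive : semi_sigma_additive lam.
Proof.
move=> F mF tF mU; rewrite /lam setI_bigcupr.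
have mIF i : measurable (@I01 R `&` F i).
  by apply: measurableI => //; exact: measurable_I01.
apply: (@measure_semi_sigma_additive _ _ _ (@lebesgue_measure R)) => //.
  exact: trivIset_setIl.
suff : measurable (\bigcup_n (@I01 R `&` F n)) by [].
by apply: bigcup_measurable => i _; exact: mIF.
Qed.

HB.instance Definition _ := isMeasure.Build _ _ _ lam
  lam0 lam_ge0 lam_sigma_additive.

Lemma lam_setT : lam setT = 1%E.
Proof.
rewrite /lam setIT /I01 lebesgue_measure_itv /= lte_fin ltr01.
by rewrite oppr0 adde0.
Qed.

HB.instance Definition _ := Measure_isProbability.Build _ _ _ lam lam_setT.

End Lambda.

(** * Cylinders of bit sequences *)

Section Bits.

(* The first [n] bits of [o], last one first. *)
Fixpoint revpre (o : nat -> bool) n : seq bool :=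
  if n is n'.+1 then o n' :: revpre o n' else [::].

Lemma size_revpre o n : size (revpre o n) = n.
Proof. by elim: n => //= n ->. Qed.


Definition bcyl (v : seq bool) : set (nat -> bool) :=
  [set o | revpre o (size v) = v].

Definition bcyls : set (set (nat -> bool)) :=
  [set Z | Z = set0 \/ exists v, Z = bcyl v].

Definition bitspace := g_sigma_algebraType bcyls.

(** A prefix determines all shorter ones, so two cylinders that meet are nested. This makes [bcyls]
    closed under intersection, as uniqueness of measures requires. *)
Lemma bcyl_sub v w : (size v <= size w)%N -> bcyl v `&` bcyl w !=set0 ->
  bcyl w `<=` bcyl v.
Proof.
rewrite /bcyl => vw [ o [/= ov ow]] o' /= o'w.
have : forall n m (o1 o2 : nat -> bool), (n <= m)%N ->
    revpre o1 m = revpre o2 m -> revpre o1 n = revpre o2 n.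
  move=> n m o1 o2; elim: m => [|m IH]; first by rewrite leqn0 => /eqP ->.
  rewrite leq_eqVlt => /predU1P[-> //|]; rewrite ltnS => nm /= [_ /IH]; exact.
by move=> /(_ _ _ o' o vw); rewrite o'w ow ov => /(_ erefl).
Qed.

Lemma bcyls_setI : setI_closed bcyls.
Proof.
move=> A B [->|[v ->]]; first by move=> _; left; rewrite set0I.
move=> [->|[w ->]]; first by left; rewrite setI0.
have [|/set0P ne] := eqVneq (bcyl v `&` bcyl w) set0; first by move=> ->; left.
right; have [vw|/ltnW wv] := leqP (size v) (size w).
  by exists w; apply/setIidr/bcyl_sub.
by exists v; apply/setIidl/bcyl_sub; rewrite // setIC.
Qed.

Lemma measurable_bcyl v : @measurable _ bitspace (bcyl v).
Proof. by apply: sub_sigma_algebra; right; exists v. Qed.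

Lemma measurable_bit m : @measurable _ bitspace [set o : nat -> bool | o m].
Proof.
have -> : [set o : nat -> bool | o m] =
    \bigcup_(v in [set v | size v = m.+1 /\ head false v]) bcyl v.
  apply/seteqP; split => [ o /= om|o [v [sv hv]]].
    by exists (revpre o m.+1) => //=; rewrite /bcyl /= size_revpre.
  by rewrite /bcyl /= sv /= => ov; move: hv; rewrite -ov.
by apply: countable_bigcup_measurable => v _; exact: measurable_bcyl.
Qed.

Lemma measurable_bcyl_preimage d (T : measurableType d) (b : T -> nat -> bool) :
  (forall m, measurable [set x | b x m]) ->
  forall v, measurable [set x | revpre (b x) (size v) = v].
Proof.
move=> mb; elim => [|c v IH]; first by rewrite (_ : mkset _ = setT) //=; apply/seteqP; split.
rewrite (_ : mkset _ = [set x | b x (size v) = c] `&`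
   [set x | revpre (b x) (size v) = v]); last first.
  by apply/seteqP; split => x /= => [[-> ->]//|[-> ->]].
apply: measurableI => //.
case: c; first exact: mb.
rewrite (_ : mkset _ = ~` [set x | b x (size v)]); first exact: measurableC.
by apply/seteqP; split => x /=; [move=> ->|move=> /negP/negbTE].
Qed.

Lemma measurable_fun_bits d (T : measurableType d) (b : T -> bitspace) :
  (forall m, measurable [set x | b x m]) -> measurable_fun setT b.
Proof.
move=> mb; apply: (@measurability _ _ T bitspace setT b bcyls) => // _ [Z + <-].
rewrite setTI; case=> [->|[v ->]]; first by rewrite preimage_set0.
exact: measurable_bcyl_preimage.
Qed.

End Bits.

(** * A parameter from a code by bits *)

Section CodedParameter.
Variables (R : realType) (d : measure_display) (T : measurableType d).
Variables (P : probability T R) (b : T -> nat -> bool).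
Hypothesis mb : forall m, measurable [set x | b x m].

Let C v := [set x | revpre (b x) (size v) = v].
Let m v : R := fine (P (C v)).

Let mC v : measurable (C v). Proof. exact: measurable_bcyl_preimage. Qed.

Let PE v : P (C v) = (m v)%:E.
Proof. by rewrite fineK// fin_num_measure. Qed.

Let m_ge0 v : 0 <= m v. Proof. by rewrite -lee_fin -PE. Qed.

Let m_split v : m v = m (false :: v) + m (true :: v).
Proof.
apply: EFin_inj; rewrite EFinD -!PE -measureU//; last first.
  by apply/seteqP; split => // x; rewrite /C /= => -[[-> _] []].
congr (P _); apply/seteqP; split => x; rewrite /C /=; last by case=> -[_ ->].
move=> Cx; rewrite Cx; case: (b x (size v)); [right|left]; reflexivity.
Qed.

(* The points of [0, 1) with address [v] form the interval starting at
   [lower_end v] of length [m v]; words are stored last digit first. *)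
Fixpoint lower_end (v : seq bool) : R :=
  if v is c :: v' then lower_end v' + (if c then m (false :: v') else 0) else 0.

Let lower_end_bound v : 0 <= lower_end v /\ lower_end v + m v <= 1.
Proof.
elim: v => [|c v [l0 l1]] /=.
  split => //; rewrite add0r -lee_fin -PE; exact: probability_le1.
have := m_split v; have := m_ge0 (false :: v); have := m_ge0 (true :: v).
by case: c => h0 h1 h2; split; lra.
Qed.

Fixpoint address (t : R) n : seq bool :=
  if n is n'.+1 then
    (lower_end (address t n') + m (false :: address t n') <= t) :: address t n'
  else [::].

Definition digit (t : R) n : bool :=
  lower_end (address t n) + m (false :: address t n) <= t.

Let revpre_digit t n : revpre (digit t) n = address t n.
Proof. by elim: n => //= n ->. Qed.

Let size_address t n : size (address t n) = n.
Proof. by elim: n => //= n ->. Qed.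

Let addressP t v : 0 <= t < 1 ->
  address t (size v) = v <-> lower_end v <= t < lower_end v + m v.
Proof.
move=> t01; elim: v => [|c v IH] /=.
  rewrite add0r (_ : m [::] = 1)//.
  apply: EFin_inj; rewrite -PE -(probability_setT P).
  by congr (P _); apply/seteqP; split.
have h := m_split v; have h0 := m_ge0 (false :: v); have h1 := m_ge0 (true :: v).
split.
  move=> [+ E]; rewrite E; move: E => /IH /andP[].
  by case: c; case: lerP => // *; apply/andP; split; lra.
move=> /andP[lt tl].
have /IH -> : lower_end v <= t < lower_end v + m v.
  by case: c lt tl => lt tl; apply/andP; split; lra.
by congr (_ :: _); case: c lt tl => lt tl; case: lerP => //; lra.
Qed.

Lemma measurable_digit k : measurable [set t | digit t k].
Proof.
have mA : forall v, measurable [set t | address t (size v) = v].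
  elim => [|c v IH]; first by rewrite (_ : mkset _ = setT) //=; apply/seteqP; split.
  rewrite (_ : mkset _ = [set t | (lower_end v + m (false :: v) <= t) = c] `&`
     [set t | address t (size v) = v]); last first.
    by apply/seteqP; split => x /= => [[<- ->]//|[<- ->]].
  apply: measurableI => //.
  case: c.
    rewrite (_ : mkset _ = `[lower_end v + m (false :: v), +oo[%classic) //.
    by apply/seteqP; split => x /=; rewrite in_itv /= andbT.
  rewrite (_ : mkset _ = `]-oo, lower_end v + m (false :: v)[%classic) //.
  by apply/seteqP; split => x /=; rewrite in_itv /= ltNge; [move=> ->|move=> /negbTE].
rewrite (_ : mkset _ = \bigcup_(v in [set v | size v = k])
  ([set t | address t (size v) = v] `&` [set t | lower_end v + m (false :: v) <= t])).
  apply: countable_bigcup_measurable => v _; apply: measurableI => //.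
  rewrite (_ : mkset _ = `[lower_end v + m (false :: v), +oo[%classic) //.
  by apply/seteqP; split => x /=; rewrite in_itv /= andbT.
apply/seteqP; split => [t /= kt|t [v /= sv []]].
  by exists (address t k) => /=; rewrite size_address.
by rewrite /digit sv => ->.
Qed.

Lemma lam_digit v : lam [set t | revpre (digit t) (size v) = v] = P (C v).
Proof.
rewrite /lam PE (_ : _ `&` _ = `[lower_end v, lower_end v + m v[%classic).
  rewrite lebesgue_measure_itv /= lte_fin.
  case: ifPn; first by move=> _; rewrite -EFinB addrAC subrr add0r.
  rewrite -leNgt -subr_ge0 => h; have := m_ge0 v => h'.
  by congr (_%:E); lra.
have [l0 l1] := lower_end_bound v.
apply/seteqP; split => t; rewrite /I01 /= !in_itv /= revpre_digit.
  by move=> [t01] /addressP; exact.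
move=> h; have t01 : 0 <= t < 1 by case/andP: h => h1 h2; apply/andP; split; lra.
by split => //; apply/addressP.
Qed.

(** The digits of a uniform point of [0, 1) have the law of the code [b] under [P]: both laws agree
    on cylinders by [lam_digit], hence on all measurable sets. Decoding turns this law into [P],
    because [dec] inverts [b]. *)
Lemma coded_parameter (dec : bitspace -> T) : measurable_fun setT dec ->
  (forall x, dec (b x) = x) ->
  exists2 phi : R -> T, measurable_fun setT phi &
    forall B, measurable B -> lam (phi @^-1` B) = P B.
Proof.
move=> mdec bK.
have mdig : measurable_fun setT (digit : R -> bitspace).
  by apply: measurable_fun_bits; exact: measurable_digit.
have mbb : measurable_fun setT (b : T -> bitspace) by exact: measurable_fun_bits.
exists (dec \o digit); first exact: measurableT_comp.
move=> B mB.
have mdB : measurable (dec @^-1` B) by rewrite -[_ @^-1` _]setTI; exact: mdec.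
have -> : P B = pushforward P (b : T -> bitspace) (dec @^-1` B).
  by rewrite /pushforward; congr (P _); apply/seteqP; split => x /=; rewrite bK.
pose m1 := [the measure _ _ of pushforward (@lam R) (digit : R -> bitspace)].
pose m2 := [the measure _ _ of pushforward P (b : T -> bitspace)].
apply: (@measure_unique _ R bitspace bcyls (fun=> setT) _ _ _ _ (m1 mdig) (m2 mbb)) => //.
- exact: bcyls_setI.
- by move=> _; right; exists [::]; apply/seteqP; split.
- by apply/seteqP; split => // x _; exists 0%N.
- by move=> A [->|[v ->]]; rewrite ?measure0//; exact: lam_digit.
- by move=> _; rewrite /m1 /= /pushforward preimage_setT lam_setT ltry.
Qed.

End CodedParameter.

Notation mdist X := (@mm_d _ X).
Notation bspace X := (g_sigma_algebraType (metric_open (mdist X))).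

(** * Codes of products, of Polish spaces and of the line *)

Section Coded.

(* [T] is a measurable retract of the space of bit sequences. *)
Definition coded d (T : measurableType d) :=
  exists (b : T -> nat -> bool) (dec : bitspace -> T),
    [/\ forall m, measurable [set x | b x m], measurable_fun setT dec &
        forall x, dec (b x) = x].

(** The two codes are interleaved: even digits for the first factor, odd digits for the second. *)
Lemma coded_prod d1 d2 (T1 : measurableType d1) (T2 : measurableType d2) :
  coded T1 -> coded T2 -> coded (T1 * T2)%type.
Proof.
move=> [b1 [c1 [mb1 mc1 bK1]]] [b2 [c2 [mb2 mc2 bK2]]].
exists (fun x m => if odd m then b2 x.2 m./2 else b1 x.1 m./2).
exists (fun o => (c1 (fun k => o k.*2), c2 (fun k => o k.*2.+1))); split.
- move=> m; case: (odd m).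
    have := @measurable_snd _ _ T1 T2 measurableT _ (mb2 m./2).
    by rewrite setTI.
  have := @measurable_fst _ _ T1 T2 measurableT _ (mb1 m./2).
  by rewrite setTI.
- apply: measurable_fun_pair.
    apply: (@measurableT_comp _ _ _ bitspace bitspace _ c1) => //.
    by apply: measurable_fun_bits => k; exact: measurable_bit.
  apply: (@measurableT_comp _ _ _ bitspace bitspace _ c2) => //.
  by apply: measurable_fun_bits => k; exact: measurable_bit.
- move=> [x y] /=; congr (_, _).
    rewrite -[RHS]bK1; congr c1; apply/funext => k.
    by rewrite odd_double doubleK.
  rewrite -[RHS]bK2; congr c2; apply/funext => k.
  by rewrite /= odd_double /= uphalf_double.
Qed.

Variable R : realType.

Lemma exists_natSinv_lt (e : R) : 0 < e -> exists k : nat, k.+1%:R^-1 < e.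
Proof.
move=> e0; have [k _ /(_ k (leqnn k)) h] := near_infty_natSinv_lt (PosNum e0).
by exists k.
Qed.

(** With a dense sequence [u], the bit of index (j, k) of a point tells whether [u j] is within 1 /
    (k + 1) of it. To decode, take for each [k] the first such [j] and pass to the limit;
    completeness provides the limit. *)
Lemma coded_polish (T : pointedType) (dist : T -> T -> R) :
  is_metric dist -> metric_complete dist -> metric_separable dist ->
  coded (g_sigma_algebraType (metric_open dist)).
Proof.
move=> [d_ge0 [d0 [dC dT]]] cplt [u du].
pose r (k : nat) : R := k.+1%:R^-1.
have r0 k : 0 < r k by rewrite /r invr_gt0.
have rlt e : 0 < e -> exists k, r k < e by exact: exists_natSinv_lt.
pose b (x : T) (m : nat) : bool :=
  if unpickle m is Some jk then dist x (u jk.1) < r jk.2 else false.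
have bE x j k : b x (pickle (j, k)) = (dist x (u j) < r k) by rewrite /b pickleK.
(* The least index makes the choice measurable: its value is settled by countably many bits. The
   value 0 is a default for sequences with no bit set at level [k]. *)
pose idx (o : bitspace) (k : nat) : nat :=
  match pselect (exists j : nat, o (pickle (j, k))) with
  | left ex => ex_minn ex | right _ => 0%N end.
have idxP (o : bitspace) (k j : nat) : o (pickle (j, k)) -> o (pickle (idx o k, k)).
  by move=> oj; rewrite /idx; case: pselect => [ex|[]]; [case: ex_minnP|exists j].
have mo (j k : nat) : @measurable _ bitspace [set o : nat -> bool | o (pickle (j, k))].
  exact: measurable_bit.
have mE (k j : nat) : @measurable _ bitspace [set o | idx o k = j].
  pose M := [set o : nat -> bool | o (pickle (j, k))] `&`
     \bigcap_(i in [set i | (i < j)%N]) ~` [set o : nat -> bool | o (pickle (i, k))].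
  pose N := if j == 0%N then
    \bigcap_i ~` [set o : nat -> bool | o (pickle (i : nat, k))] else set0.
  have -> : [set o | idx o k = j] = M `|` N.
    apply/seteqP; split => o /=; rewrite /idx /M /N; case: pselect => ex /=.
    - case: ex_minnP => m om mm <-; left; split => // i /= im oi.
      by have := mm _ oi; rewrite leqNgt im.
    - by move=> <-; right => i _ /= oi; apply: ex; exists i.
    - case=> [[oj oi]|].
        case: ex_minnP => m om mm; apply/eqP; rewrite eqn_leq mm //= leqNgt.
        by apply/negP => /oi.
      by case: eqP => // _ h; case: ex => i oi; have := h i Logic.I.
    - by case=> [[oj _]|]; [case: ex; exists j|case: eqP].
  apply: measurableU.
    apply: measurableI; first exact: mo.
    by apply: bigcap_measurableType => i _; apply: measurableC; exact: mo.
  rewrite /N; case: ifP => // _.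
  by apply: bigcap_measurableType => i _; apply: measurableC; exact: mo.
pose a (o : bitspace) k := u (idx o k).
(* On [C] the approximants are Cauchy with an explicit rate; off [C] the decoder returns [point].
   Codes of actual points lie in [C] by the triangle inequality. *)
pose C := [set o | forall k l, dist (a o k) (a o l) <= r k + r l].
have mP (P : T -> Prop) k : @measurable _ bitspace [set o | P (a o k)].
  have -> : [set o | P (a o k)] =
      \bigcup_(j in [set j | P (u j)]) [set o | idx o k = j].
    apply/seteqP; split => o /=; first by move=> Po; exists (idx o k).
    by case=> j /= Pj; rewrite /a => ->.
  by apply: bigcup_measurable => j _; exact: mE.
have mC : @measurable _ bitspace C.
  have -> : C = \bigcap_k \bigcap_l \bigcup_j
      ([set o | idx o k = j] `&` [set o | dist (u j) (a o l) <= r k + r l]).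
    apply/seteqP; split => o /=.
      by move=> Co k _ l _; exists (idx o k) => //; split => //; exact: Co.
    by move=> Co k l; have [j _ [/= <-]] := Co k Logic.I l Logic.I.
  apply: bigcap_measurableType => k _.
  apply: bigcap_measurableType => l _.
  apply: bigcup_measurable => j _; apply: measurableI => //.
  exact: (mP (fun y => dist (u j) y <= r k + r l)).
have lims o : exists x, C o -> forall k, dist (a o k) x <= r k.
  case: (pselect (C o)) => [Co|nCo]; last by exists point.
  have [|x ax] := cplt (a o).
    move=> e e0; have [N N1] := rlt (e / 2) ltac:(lra).
    exists N => m n Nm Nn; apply: (le_lt_trans (Co m n)).
    have rN k : (N <= k)%N -> r k <= r N.
      by move=> Nk; rewrite /r lef_pV2 ?posrE// ler_nat ltnS.
    by have := rN m Nm; have := rN n Nn; lra.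
  exists x => _ k; rewrite leNgt; apply/negP => h.
  have [N1 h1] := ax ((dist (a o k) x - r k)/2) ltac:(lra).
  have [N2 h2] := rlt ((dist (a o k) x - r k)/2) ltac:(lra).
  have := h1 (maxn N1 N2) (leq_maxl _ _).
  have := dT (a o k) (a o (maxn N1 N2)) x; have := Co k (maxn N1 N2).
  have : r (maxn N1 N2) <= r N2 by rewrite /r lef_pV2 ?posrE// ler_nat ltnS leq_maxr.
  by move: (r (maxn N1 N2)) (dist (a o k) (a o _)) (dist (a o (maxn _ _)) x) => *; lra.
have [lim limP] := choice lims.
exists b, (fun o => if `[< C o >] then lim o else point); split.
- move=> m; rewrite /b; case: unpickle => [[j k]|]; last first.
    by rewrite (_ : mkset _ = set0) //; apply/seteqP; split.
  apply: sub_sigma_algebra => x /= xj.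
  exists (r k - dist x (u j)); split; first lra.
  by move=> y xy /=; have := dT y x (u j); rewrite (dC y x) /=; lra.
- apply: (@measurability _ _ bitspace (g_sigma_algebraType (metric_open dist)) _ _
    (metric_open dist)) => // _ [A oA <-]; rewrite setTI.
  (* The limit lies in the open set [A] exactly when some closed ball of radius [r k] around the
     [k]-th approximant is contained in [A]; this condition involves one value of [idx] at a
     time. *)
  have -> : (fun o : bitspace => if `[< C o >] then lim o else point) @^-1` A =
     (C `&` \bigcup_k [set o | forall y, dist (a o k) y <= r k -> A y]) `|`
     (~` C `&` [set o | A point]).
    apply/seteqP; split => o /=.
      case: asboolP => Co Ao; [left|by right].
      split => //; have [e [e0 eA]] := oA _ Ao.
      have [k ke] := rlt (e/2) ltac:(lra); exists k => //= y ay.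
      apply: eA; have := dT (lim o) (a o k) y; have := limP _ Co k.
      by rewrite (dC (lim o) (a o k)) => *; lra.
    case=> [[Co [k _ /= h]]|[nCo Ap]]; case: asboolP => // _.
    exact/h/limP.
  apply: measurableU.
    apply: measurableI => //; apply: bigcup_measurable => k _.
    exact: (mP (fun z => forall y, dist z y <= r k -> A y)).
  apply: measurableI; first exact: measurableC.
  case: (pselect (A point)) => h; first by rewrite (_ : mkset _ = setT) //; apply/seteqP; split.
  by rewrite (_ : mkset _ = set0) //; apply/seteqP; split.
- move=> x.
  have bx k : dist x (a (b x) k) < r k.
    have [j xj] := du x (r k) (r0 k).
    have : b x (pickle (j, k)) by rewrite bE.
    by move=> /idxP; rewrite bE.
  have Cx : C (b x).
    move=> k l; have := dT (a (b x) k) x (a (b x) l); have := bx k; have := bx l.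
    by rewrite (dC _ x) => *; lra.
  case: asboolP => // _; apply/d0/eqP; rewrite eq_le d_ge0 andbT leNgt.
  apply/negP => h.
  have [k hk] := rlt (dist (lim (b x)) x / 2) ltac:(lra).
  have := limP _ Cx k; have := bx k; have := dT (lim (b x)) (a (b x) k) x.
  by rewrite (dC x) (dC (lim _) (a _ _)) => *; lra.
Qed.

Lemma is_metric_real : is_metric (fun x y : R => `|x - y|).
Proof.
split=> [x y|]; first exact: normr_ge0.
split=> [x y|]; first by split=> [/normr0_eq0/subr0_eq//|->]; rewrite subrr normr0.
split=> [x y|x y z]; first exact: distrC.
by have := ler_normD (x - y) (y - z); rewrite (_ : x - y + (y - z) = x - z)//; ring.
Qed.

Lemma coded_real : coded R.
Proof.
have [|||b [dec [mb mdec bK]]] := @coded_polish R (fun x y : R => `|x - y|).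
- exact: is_metric_real.
- move=> v cv; have : cvg (v @ \oo).
    apply/cauchy_cvgP/cauchy_ballP => e e0; have [N hN] := cv e e0.
    exists (v @` [set n | (N <= n)%N], v @` [set n | (N <= n)%N]).
      by split; exists N => // n Nn; exists n.
    by move=> [_ _] [/= [m Nm <-] [n Nn <-]]; exact: hN.
  move=> /cvgrPdist_lt h; exists (lim (v @ \oo)) => e e0.
  have [N _ hN] := h e e0; exists N => n Nn.
  by rewrite distrC; exact: hN.
- exists (fun n => if unpickle n is Some q then ratr q else 0) => x e e0.
  have [q] := @rat_in_itvoo R (x - e) (x + e) ltac:(lra).
  rewrite in_itv /= => /andP[h1 h2]; exists (pickle q); rewrite pickleK.
  by rewrite ltr_norml; apply/andP; split; lra.
have sub : @measurable _ R `<=`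
    @measurable _ (g_sigma_algebraType (metric_open (fun x y : R => `|x - y|))).
  have /= -> : @measurable _ R = _ := measurable_realfun.RGenOpens.measurableE R.
  apply: smallest_sub.
    exact: smallest_sigma_algebra.
  move=> _ [a [b' ->]]; apply: sub_sigma_algebra => x /=.
  rewrite in_itv /= => /andP[ax xb].
  exists (Num.min (x - a) (b' - x)); rewrite lt_min; split.
    by apply/andP; split; lra.
  move=> y; rewrite lt_min !ltr_norml in_itv /= => /andP[/andP[h1 h2] /andP[h3 h4]].
  by apply/andP; split; lra.
exists b, dec; split => //.
- move=> m; suff sub' : @measurable _ (g_sigma_algebraType
      (metric_open (fun x y : R => `|x - y|))) `<=` @measurable _ R by apply: sub'; exact: mb.
  apply: smallest_sub; first exact: sigma_algebra_measurable.
  move=> A oA; apply: open_measurable; rewrite openE => x /oA[e [e0 eA]].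
  by exists e => // y /eA.
- by move=> _ B /sub mB; have := mdec measurableT _ mB; rewrite setTI.
Qed.

Lemma coded_lam_image d (T : measurableType d) (P : probability T R) : coded T ->
  exists2 phi : R -> T, measurable_fun setT phi &
    forall B, measurable B -> lam (phi @^-1` B) = P B.
Proof. by move=> [b [dec [mb mdec bK]]]; exact: coded_parameter mb _ mdec bK. Qed.

Lemma lam_image_square : exists2 kappa : R -> R * R, measurable_fun setT kappa &
  forall B, measurable B -> lam (kappa @^-1` B) = (@lam R \x @lam R)%E B.
Proof.
exact: (coded_lam_image [the probability _ _ of (@lam R \x @lam R)%E]
  (coded_prod coded_real coded_real)).
Qed.

Lemma mmspace_lam_image (X : mmspace R) :
  exists2 phi : R -> bspace X,
    measurable_fun setT phi &
    forall B, measurable B -> lam (phi @^-1` B) = mm_P X B.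
Proof.
apply: coded_lam_image; apply: coded_polish.
- exact: mm_metric. - exact: mm_complete. - exact: mm_separable.
Qed.

End Coded.

(** * Infima of nonnegative sets and McShane's extension *)

Section Infima.
Variable R : realType.

Lemma inf_ge0 (A : set R) : (forall x, A x -> 0 <= x) -> 0 <= inf A.
Proof.
move=> A0; have [->|/set0P ne] := eqVneq A set0; first by rewrite inf0.
exact: lb_le_inf.
Qed.

Lemma inf_le_mem (A : set R) (x : R) : (forall y, A y -> 0 <= y) -> A x -> inf A <= x.
Proof. by move=> A0 Ax; apply: ge_inf => //; exists 0. Qed.

Lemma inf_lt_mem (A : set R) (e : R) : (forall y, A y -> 0 <= y) -> A !=set0 ->
  inf A < e -> exists2 x, A x & x < e.
Proof.
move=> A0 ne; rewrite -subr_gt0 => h.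
have [|x Ax xe] := @inf_adherent R A (e - inf A) h; first by split => //; exists 0.
by exists x => //; move: xe; rewrite addrCA subrr addr0.
Qed.

(* McShane's extension, applied to a function which is 1-Lipschitz up to an
   additive error [eta]. *)
Lemma mcshane (M S : Type) (d : M -> M -> R) (G : set S) (a : S -> M) (v : S -> R)
    (eta : R) : is_metric d -> 0 <= eta ->
  (forall p q, G p -> G q -> v p - v q <= d (a p) (a q) + eta) ->
  exists2 g : M -> R, (forall x y, `|g x - g y| <= d x y) &
    forall p, G p -> `|g (a p) - v p| <= eta.
Proof.
move=> [d_ge0 [d0 [dC dT]]] eta0 Gv.
have [->|/set0P [p0 Gp0]] := eqVneq G set0.
  by exists (fun=> 0) => // x y; rewrite subrr normr0.
pose E x := [set v p + d x (a p) | p in G].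
have lbE x : has_lbound (E x).
  exists (v p0 - d x (a p0) - eta) => _ [p Gp <-].
  have := Gv p0 p Gp0 Gp; have := dT (a p0) x (a p); rewrite (dC (a p0) x).
  by move=> *; lra.
have E0 x : E x !=set0 by exists (v p0 + d x (a p0)); exists p0.
exists (fun x => inf (E x)) => [x y|p Gp].
  have half x' y' : inf (E x') - inf (E y') <= d x' y'.
    rewrite lerBlDr -lerBlDl; apply: lb_le_inf => // _ [p Gp <-].
    rewrite lerBlDl; apply: (@le_trans _ _ (v p + d x' (a p))).
      by apply: ge_inf => //; exists p.
    by have := dT x' y' (a p); lra.
  by rewrite ler_norml; have := half x y; have := half y x; rewrite dC; lra.
have h1 : inf (E (a p)) <= v p.
  apply: ge_inf => //; exists p => //.
  by rewrite (_ : d (a p) (a p) = 0) ?addr0//; apply/d0.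
have h2 : v p - eta <= inf (E (a p)).
  apply: lb_le_inf => // _ [q Gq <-].
  by have := Gv p q Gp Gq; lra.
by rewrite ler_norml; lra.
Qed.

End Infima.

(** * Metric preserving functions *)

Section MetricPreserving.
Variable R : realType.
Implicit Types (F : R -> R -> R) (a b r s t x y : R).

Lemma is_metric_sup : is_metric
  (fun p q : R * R => Num.max `|p.1 - q.1| `|p.2 - q.2|).
Proof.
have [_ [m0 [mC mT]]] := is_metric_real R.
split=> [p q|]; first by rewrite le_max normr_ge0.
split=> [[x y] [x' y'] /=|].
  split=> [h|[-> ->]]; last by rewrite !subrr normr0 maxxx.
  have : `|x - x'| <= 0 /\ `|y - y'| <= 0.
    by rewrite -[in X in X /\ _]h -[in X in _ /\ X]h !le_max !lexx orbT.
  rewrite !normr_le0 !subr_eq0 => -[/eqP-> /eqP->//].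
split=> [p q|p q r]; first by rewrite mC (mC p.2).
rewrite ge_max; apply/andP; split.
  by apply: (le_trans (mT _ q.1 _)); apply: lerD; rewrite le_max lexx.
by apply: (le_trans (mT _ q.2 _)); apply: lerD; rewrite le_max lexx orbT.
Qed.

Lemma mp_metric F : metric_preserving2 F ->
  is_metric (fun p q : R * R => F `|p.1 - q.1| `|p.2 - q.2|).
Proof. by move=> mF; exact: mF (is_metric_real R) (is_metric_real R). Qed.

Lemma mp_ge0 F a b : metric_preserving2 F -> 0 <= a -> 0 <= b -> 0 <= F a b.
Proof.
move=> /mp_metric[+ _] a0 b0 => /(_ (a, b) (0, 0)) /=.
by rewrite !subr0 !ger0_norm.
Qed.

Lemma mp_00 F : metric_preserving2 F -> F 0 0 = 0.
Proof.
move=> /mp_metric[_ [+ _]] => /(_ (0, 0) (0, 0)) /=.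
by rewrite !subr0 normr0 => -[_]; exact.
Qed.

(** Triangle inequality for [d_F] on the plane at (0, 0), (a', b') and (a, b). It stands in for
    monotonicity, which a metric preserving function may lack. *)
Lemma mp_perturb F a b a' b' : metric_preserving2 F ->
  0 <= a -> 0 <= b -> 0 <= a' -> 0 <= b' ->
  F a b <= F a' b' + F `|a - a'| `|b - b'|.
Proof.
move=> /mp_metric[_ [_ [mC mT]]] a0 b0 a0' b0'.
have := mT (0, 0) (a', b') (a, b); rewrite /= !sub0r !normrN.
rewrite (ger0_norm a0) (ger0_norm b0) (ger0_norm a0') (ger0_norm b0').
by rewrite (distrC a') (distrC b').
Qed.

(* The triangle with sides [x], [r], [r] exists whenever [x <= 2 r]; this bounds
   a metric preserving function near the origin by its diagonal values. *)
Lemma mp_le_diag F x y r : metric_preserving2 F ->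
  0 <= x <= 2 * r -> 0 <= y <= 2 * r -> F x y <= 2 * F r r.
Proof.
move=> mF /andP[x0 xr] /andP[y0 yr].
have [_ [_ [_ mT]]] := mF _ _ _ _ is_metric_sup is_metric_sup.
(* The triangle is drawn in the plane with the sup metric, with vertices (0, 0), (z / 2, r), (z, 0):
   its legs have length [r] because [z / 2 <= r]. *)
have E (z : R) : 0 <= z -> z <= 2 * r -> [/\ Num.max `|0 - z| `|0 - 0 : R| = z :> R,
    Num.max `|0 - z / 2| `|0 - r| = r :> R &
    Num.max `|z / 2 - z| `|r - 0| = r :> R].
  move=> z0 zr; split.
  - by rewrite sub0r normrN subr0 normr0 ger0_norm // max_l.
  - rewrite !sub0r !normrN !ger0_norm ?max_r //; lra.
  - rewrite (_ : z / 2 - z = - (z / 2)); last by field.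
    rewrite normrN subr0 !ger0_norm ?max_r //; lra.
have [Ex1 Ex2 Ex3] := E x x0 xr; have [Ey1 Ey2 Ey3] := E y y0 yr.
have := mT ((0, 0), (0, 0)) ((x / 2, r), (y / 2, r)) ((x, 0), (y, 0)).
by rewrite /= Ex1 Ex2 Ex3 Ey1 Ey2 Ey3 mulr2n mulrDl !mul1r.
Qed.

Lemma F2_small F (e : R) : in_F2 F -> 0 < e -> exists2 r, 0 < r & F r r < e.
Proof.
move=> [mF cF] e0.
have h : (fun p : R * R => F p.1 p.2) @
    within [set p : R * R | 0 <= p.1 /\ 0 <= p.2] (nbhs ((0, 0) : R * R)) --> F 0 0.
  have := cF (0, 0); rewrite /continuous_at /= nbhs_subspace_in //=.
move/cvgrPdist_lt : h => /(_ e e0); rewrite near_withinE /=.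
move=> /nbhs_ballP[r /= r0 rP].
have r20 : 0 < r / 2 by lra.
exists (r / 2) => //.
have := rP (r / 2, r / 2); rewrite mp_00 // sub0r normrN.
have Br : ball ((0, 0) : R * R) r (r / 2, r / 2).
  by split; rewrite /= -ball_normE /= sub0r normrN ger0_norm; lra.
have A0 : 0 <= r / 2 /\ 0 <= r / 2 by split; exact: ltW.
by move=> /(_ Br A0); apply: le_lt_trans; exact: ler_norm.
Qed.

Definition upper_inf F s t :=
  inf [set F s' t' | s' in [set s' | s <= s'] & t' in [set t' | t <= t']].

Lemma upper_inf_le F s t s' t' : metric_preserving2 F -> 0 <= s -> 0 <= t ->
  s <= s' -> t <= t' -> upper_inf F s t <= F s' t'.
Proof.
move=> mF s0 t0 ss tt; apply: inf_le_mem; last by exists s' => //; exists t'.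
move=> _ [x /= sx [y /= ty <-]]; by apply: mp_ge0 => //; [exact: le_trans sx|exact: le_trans ty].
Qed.

Variables (Fn : nat -> R -> R -> R) (F : R -> R -> R).
Hypotheses (Fn2 : forall n, in_F2 (Fn n)) (F2 : in_F2 F).
Hypothesis FnF : forall s t : R, 0 <= s -> 0 <= t -> (fun n => Fn n s t) @ \oo --> F s t.

Lemma near_cvgF s t (e : R) : 0 <= s -> 0 <= t -> 0 < e ->
  \forall n \near \oo, `|Fn n s t - F s t| < e.
Proof.
move=> s0 t0 e0; have /cvgrPdist_lt /(_ e e0) := FnF s0 t0.
by apply: filterS => n; rewrite distrC.
Qed.

(** By [mp_perturb] and [mp_le_diag], moving both arguments by at most [r] costs at most
    [2 * Fn n r r], which for large [n] is close to [2 * F r r]. Hence [rho] depends neither on [n]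
    nor on [a], [b]; only the rank from which the last two estimates hold depends on (a, b). *)
Lemma mp_equicontinuous (eta : R) : 0 < eta -> exists2 rho : R, 0 < rho &
  [/\ forall a b a' b', 0 <= a -> 0 <= b -> 0 <= a' -> 0 <= b' ->
        `|a' - a| <= rho -> `|b' - b| <= rho -> F a' b' <= F a b + eta,
      forall a b, 0 <= a -> 0 <= b -> \forall n \near \oo,
        forall a' b', 0 <= a' -> 0 <= b' ->
        `|a' - a| <= rho -> `|b' - b| <= rho -> Fn n a' b' <= F a b + eta &
      (forall s t : R, 0 <= s -> 0 <= t ->
        (fun n => Fn n s t - upper_inf (Fn n) s t) @ \oo --> (0 : R)) ->
      forall a b, 0 <= a -> 0 <= b -> \forall n \near \oo,
        forall a' b', 0 <= a' -> 0 <= b' ->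
        a - rho <= a' -> b - rho <= b' -> F a b <= Fn n a' b' + eta].
Proof.
move=> eta0; have eta80 : 0 < eta / 8 by lra.
have [r r0 Fr] := F2_small F2 eta80.
exists r => //; split.
- move=> a b a' b' a0 b0 a0' b0' ha hb.
  have := mp_perturb F2.1 a0' b0' a0 b0.
  have := @mp_le_diag F `|a' - a| `|b' - b| r F2.1.
  rewrite !normr_ge0 /= => h1 h2.
  have := h1 ltac:(lra) ltac:(lra); lra.
- move=> a b a0 b0.
  near=> n => a' b' a0' b0' ha hb.
  have := mp_perturb (Fn2 n).1 a0' b0' a0 b0.
  have := @mp_le_diag (Fn n) `|a' - a| `|b' - b| r (Fn2 n).1.
  rewrite !normr_ge0 /= => h1 h2.
  have {}h1 := h1 ltac:(lra) ltac:(lra).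
  have : `|Fn n r r - F r r| < eta / 8 by near: n; apply: near_cvgF; lra.
  have : `|Fn n a b - F a b| < eta / 8 by near: n; apply: near_cvgF; lra.
  by rewrite !ltr_norml; lra.
- move=> H2 a b a0 b0.
  (* The arguments are lowered by [r] and cut off at 0 to stay in the domain; every admissible (a',
     b') then dominates (u, v), and the condition is applied at that single pair. *)
  pose u := Num.max (a - r) 0; pose v := Num.max (b - r) 0.
  have u0 : 0 <= u by rewrite le_max lexx orbT.
  have v0 : 0 <= v by rewrite le_max lexx orbT.
  have au : `|a - u| <= r.
    by rewrite ler_norml /u; case: (leP (a - r) 0) => *; lra.
  have bv : `|b - v| <= r.
    by rewrite ler_norml /v; case: (leP (b - r) 0) => *; lra.
  near=> n => a' b' a0' b0' ha hb.
  have ua : u <= a' by rewrite ge_max ha.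
  have vb : v <= b' by rewrite ge_max hb.
  have g1 := upper_inf_le (Fn2 n).1 u0 v0 ua vb.
  have g2 : `|Fn n u v - upper_inf (Fn n) u v| < eta / 8.
    near: n; have /cvgrPdist_lt /(_ _ eta80) := H2 u v u0 v0.
    by apply: filterS => n; rewrite sub0r normrN.
  have g3 := mp_perturb (Fn2 n).1 a0 b0 u0 v0.
  have := @mp_le_diag (Fn n) `|a - u| `|b - v| r (Fn2 n).1.
  rewrite !normr_ge0 /= => h1.
  have {}h1 := h1 ltac:(lra) ltac:(lra).
  have : `|Fn n r r - F r r| < eta / 8 by near: n; apply: near_cvgF; lra.
  have : `|Fn n a b - F a b| < eta / 8 by near: n; apply: near_cvgF; lra.
  by move: g2; rewrite !ltr_norml; lra.
Unshelve. all: end_near.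
Qed.

End MetricPreserving.

(** * Ky Fan metric and observable distance *)

Section KyFan.
Variable R : realType.

Definition offby (T : Type) (e : R) (f g : T -> R) : set T :=
  [set x | e < `|f x - g x|].

Implicit Types (f g : R -> R) (A B : set (R -> R)).

Lemma le_lam (U V : set R) : U `<=` V -> (lam U <= lam V)%E.
Proof. by move=> UV; rewrite /lam; apply: le_outer_measure; exact: setIS. Qed.

Lemma lam_le1 (U : set R) : (lam U <= 1)%E.
Proof. by rewrite -(lam_setT R); exact: le_lam. Qed.

Lemma kyfan_ge0 f g : 0 <= kyfan f g.
Proof. by apply: inf_ge0 => e []. Qed.

Lemma kyfan_le f g (e : R) : 0 <= e ->
  (lam (offby e f g) <= e%:E)%E -> kyfan f g <= e.
Proof. by move=> e0 h; apply: inf_le_mem => [x []//|]; split. Qed.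

Lemma kyfan_le1 f g : kyfan f g <= 1.
Proof. by apply: kyfan_le => //; exact: lam_le1. Qed.

Lemma kyfan_lt f g (e : R) : kyfan f g < e ->
  (lam (offby e f g) <= e%:E)%E.
Proof.
move=> /inf_lt_mem[x []//||x [x0 xP] xe].
  by exists 1; split => //; exact: lam_le1.
apply: (@le_trans _ _ (lam (offby x f g))).
  by apply: le_lam => y /=; exact: lt_trans.
by apply: (le_trans xP); rewrite lee_fin ltW.
Qed.

Lemma hausdorff_ge0 A B : 0 <= hausdorff_kyfan A B.
Proof.
rewrite /hausdorff_kyfan le_max; apply/orP; left.
set S := [set _ | _ in _].
have [hS|hS] := pselect (has_sup S); last by rewrite sup_out.
have [x Sx] := hS.1; apply: (@le_trans _ _ x); last exact: sup_ubound hS.2 _ Sx.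
by case: Sx => a _ <-; apply: inf_ge0 => _ [b _ <-]; exact: kyfan_ge0.
Qed.

Lemma hausdorff_le A B (e : R) : 0 <= e ->
  (forall a, A a -> exists2 b, B b & kyfan a b <= e) ->
  (forall b, B b -> exists2 a, A a & kyfan a b <= e) ->
  hausdorff_kyfan A B <= e.
Proof.
move=> e0 AB BA.
have key (S : set R) : (forall x, S x -> x <= e) -> sup S <= e.
  move=> h; have [->|/set0P ne] := eqVneq S set0; first by rewrite sup0.
  exact: ge_sup.
rewrite /hausdorff_kyfan ge_max; apply/andP; split; apply: key => _ [x Sx <-].
  have [b Bb h] := AB x Sx; apply: le_trans h.
  by apply: inf_le_mem => [_ [c _ <-]|]; [exact: kyfan_ge0|exists b].
have [a Aa h] := BA x Sx; apply: le_trans h.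
by apply: inf_le_mem => [_ [c _ <-]|]; [exact: kyfan_ge0|exists a].
Qed.

(** [sup] of an unbounded set and [inf] of an empty set are 0 by convention. The bound [kyfan <= 1]
    and nonemptiness of [A] and [B] ensure that the extrema in [hausdorff_kyfan] are genuine. *)
Lemma hausdorff_lt A B (e : R) : A !=set0 -> B !=set0 -> hausdorff_kyfan A B < e ->
  (forall a, A a -> exists2 b, B b & kyfan a b < e) /\
  (forall b, B b -> exists2 a, A a & kyfan a b < e).
Proof.
move=> A0 B0; rewrite /hausdorff_kyfan gt_max => /andP[hA hB].
have key (I : set (R -> R)) (J : set (R -> R)) (h : (R -> R) -> (R -> R) -> R) :
    (forall i j, 0 <= h i j <= 1) -> J !=set0 ->
    sup [set inf [set h i j | j in J] | i in I] < e ->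
    forall i, I i -> exists2 j, J j & h i j < e.
  move=> h01 [j0 Jj0] hs i Ii.
  have : inf [set h i j | j in J] < e.
    apply: le_lt_trans hs; apply: ub_le_sup; last by exists i.
    exists 1 => _ [k _ <-]; apply: (@le_trans _ _ (h k j0)).
      by apply: inf_le_mem => [_ [j _ <-]|]; [case/andP: (h01 k j)|exists j0].
    by case/andP: (h01 k j0).
  move=> /inf_lt_mem[_ [j _ <-]||_ [j Jj <-] hj]; last by exists j.
    by case/andP: (h01 i j).
  by exists (h i j0), j0.
have k01 (i j : R -> R) : 0 <= kyfan i j <= 1 by rewrite kyfan_ge0 kyfan_le1.
split; first exact: (key A B (fun a b => kyfan a b) k01 B0 hA).
exact: (key B A (fun b a => kyfan a b) (fun b a => k01 a b) A0 hB).
Qed.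

Lemma dconc_ge0 (X Y : mmdata R) : 0 <= dconc X Y.
Proof. by apply: inf_ge0 => _ [phi [psi [_ [_ ->]]]]; exact: hausdorff_ge0. Qed.

Lemma dconc_le (X Y : mmdata R) (phi : R -> md_T X) (psi : R -> md_T Y) :
  parameter phi -> parameter psi ->
  dconc X Y <= hausdorff_kyfan (pullback_Lip1 phi) (pullback_Lip1 psi).
Proof.
move=> hphi hpsi; apply: inf_le_mem; last by exists phi, psi.
by move=> _ [p [q [_ [_ ->]]]]; exact: hausdorff_ge0.
Qed.

(** The given parameters show that the infimum is not over the empty set, where it would be 0 by
    convention. *)
Lemma dconc_lt (X Y : mmdata R) (e : R) (phi0 : R -> md_T X) (psi0 : R -> md_T Y) :
  parameter phi0 -> parameter psi0 -> dconc X Y < e ->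
  exists (phi : R -> md_T X) (psi : R -> md_T Y), parameter phi /\ parameter psi /\
    hausdorff_kyfan (pullback_Lip1 phi) (pullback_Lip1 psi) < e.
Proof.
move=> h1 h2 /inf_lt_mem[_ [p [q [_ [_ ->]]]]||_ [p [q [hp [hq ->]]]] h].
- exact: hausdorff_ge0.
- by eexists; exists phi0, psi0; do 2!split => //.
- by exists p, q.
Qed.

End KyFan.

(** * Product measures and parameters of products *)

Section MeasurableProducts.
Variable R : realType.

Lemma lamU2 (U V : set R) : (lam (U `|` V) <= lam U + lam V)%E.
Proof. by rewrite /lam setIUr; exact: outer_measureU2. Qed.

Lemma eq_lam (U V : set R) : (forall x, I01 x -> (U x <-> V x)) -> lam U = lam V.
Proof.
move=> UV; rewrite /lam; congr lebesgue_measure.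
by apply/seteqP; split => x [Ix /(UV _ Ix)].
Qed.

(** Both sides are measures in [B] that agree on rectangles. *)
Lemma product_image d1 d2 d1' d2' (T1 : measurableType d1) (T2 : measurableType d2)
    (T1' : measurableType d1') (T2' : measurableType d2')
    (m1 : probability T1 R) (m2 : probability T2 R)
    (m1' : probability T1' R) (m2' : probability T2' R)
    (phi1 : T1 -> T1') (phi2 : T2 -> T2') :
  measurable_fun setT phi1 -> measurable_fun setT phi2 ->
  (forall B, measurable B -> m1 (phi1 @^-1` B) = m1' B) ->
  (forall B, measurable B -> m2 (phi2 @^-1` B) = m2' B) ->
  forall B, measurable B ->
    (m1 \x m2)%E ((fun p => (phi1 p.1, phi2 p.2)) @^-1` B) = (m1' \x m2')%E B.
Proof.
move=> mphi1 mphi2 h1 h2 B mB.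
pose phi (p : T1 * T2) := (phi1 p.1, phi2 p.2).
have mphi : measurable_fun setT phi.
  by apply: measurable_fun_pair; apply: measurableT_comp.
pose m' := [the measure _ _ of pushforward (m1 \x m2)%E phi].
symmetry; apply: (@product_measure_unique _ _ _ _ R m1' m2' (m' mphi)) => //.
move=> A1 A2 mA1 mA2.
transitivity (m1 (phi1 @^-1` A1) * m2 (phi2 @^-1` A2))%E; last by congr (_ * _)%E; [exact: h1|exact: h2].
rewrite -product_measure1E //; first by rewrite -[X in measurable X]setTI; exact: mphi1.
by rewrite -[X in measurable X]setTI; exact: mphi2.
Qed.

Lemma lip_preimage_open (T : Type) (d : T -> T -> R) (f : T -> R) (a b : R) :
  (forall x y, `|f x - f y| <= d x y) -> metric_open d (f @^-1` `]a, b[%classic).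
Proof.
move=> lf x /=; rewrite in_itv /= => /andP[ax xb].
exists (Num.min (f x - a) (b - f x)); rewrite lt_min; split; first lra.
move=> y; rewrite lt_min in_itv /=; have := lf x y; rewrite ler_norml; lra.
Qed.

Lemma measurable_lip d0 (T : measurableType d0) (d : T -> T -> R) (f : T -> R) :
  metric_open d `<=` measurable -> (forall x y, `|f x - f y| <= d x y) ->
  measurable_fun setT f.
Proof.
move=> md lf; apply: (measurability _ (RGenOpens.measurableE R)).
move=> _ [_ [a [b ->]] <-]; rewrite setTI; apply: md.
exact: lip_preimage_open.
Qed.

Lemma measurable_open_bspace (X : mmspace R) :
  metric_open (mdist X) `<=` @measurable _ (bspace X).
Proof. by move=> A oA; exact: sub_sigma_algebra. Qed.

Lemma metric_open_ball (T : Type) (d : T -> T -> R) (x : T) (r : R) :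
  is_metric d -> metric_open d [set y | d x y < r].
Proof.
move=> [_ [_ [dC dT]]] y /= xy; exists (r - d x y); split; first lra.
by move=> z yz /=; have := dT x y z; lra.
Qed.

(** The measure of [mmprod] lives on the product sigma-algebra, whereas parameters are tested on
    Borel sets of [d_F]. As [F] is small near the origin, every [d_F]-ball contains a product of two
    small balls around its center; by separability an open set is a countable union of such
    rectangles. *)
Lemma measurable_open_prod (F : R -> R -> R) (X Y : mmspace R) : in_F2 F ->
  metric_open (fun p q : mm_T X * mm_T Y => F (mdist X p.1 q.1) (mdist Y p.2 q.2))
  `<=` @measurable _ (bspace X * bspace Y)%type.
Proof.
move=> F2 A oA.
have [u uP] := mm_separable X; have [v vP] := mm_separable Y.
have [_ [_ [dXC dXT]]] := mm_metric X; have [_ [_ [dYC dYT]]] := mm_metric Y.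
have dX0 := (mm_metric X).1; have dY0 := (mm_metric Y).1.
pose r (k : nat) : R := k.+1%:R^-1.
have r0 k : 0 < r k by rewrite /r invr_gt0.
have rlt e : 0 < e -> exists k, r k < e by exact: exists_natSinv_lt.
move: r r0 rlt => r r0 rlt.
pose rect (i : nat * nat * nat) : set (mm_T X * mm_T Y) :=
  [set x | mdist X (u i.1.1) x < r i.2] `*` [set y | mdist Y (v i.1.2) y < r i.2].
have -> : A = \bigcup_(i in [set i | rect i `<=` A]) rect i.
  apply/seteqP; split => [[x y] Axy|p [i iA /iA//]].
  have [e [e0 eA]] := oA _ Axy.
  have e20 : 0 < e / 2 by lra.
  have [s s0 Fs] := F2_small F2 e20.
  have [k kr] := rlt s s0.
  have [i xi] := uP x _ (r0 k); have [j yj] := vP y _ (r0 k).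
  rewrite dXC in xi; rewrite dYC in yj.
  exists ((i, j), k); last by split; [exact: xi|exact: yj].
  move=> [x' y'] [xi' yj']; apply: eA.
  rewrite /fst /snd in xi' yj' *.
  have {}xi' : mdist X (u i) x' < r k := xi'.
  have {}yj' : mdist Y (v j) y' < r k := yj'.
  have hx := dXT x (u i) x'; have hy := dYT y (v j) y'.
  rewrite (dXC x (u i)) in hx; rewrite (dYC y (v j)) in hy.
  have hx' : 0 <= mdist X x x' <= 2 * s by rewrite dX0 /=; lra.
  have hy' : 0 <= mdist Y y y' <= 2 * s by rewrite dY0 /=; lra.
  by have := mp_le_diag F2.1 hx' hy'; lra.
apply: countable_bigcup_measurable => i _; apply: measurableX.
  by apply: measurable_open_bspace; apply: metric_open_ball; exact: mm_metric.
by apply: measurable_open_bspace; apply: metric_open_ball; exact: mm_metric.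
Qed.

Lemma measurable_borel_prod (F : R -> R -> R) (X Y : mmspace R) : in_F2 F ->
  borel_d (@md_d _ (mmprod F X Y)) `<=` @measurable _ (bspace X * bspace Y)%type.
Proof.
move=> F2; apply: smallest_sub; first exact: sigma_algebra_measurable.
exact: measurable_open_prod.
Qed.

(** A [parameter] is constrained on [0, 1) only. This variant is measurable on the whole line, which
    makes it composable; [has_law_parameter] obtains it by changing the map outside [0, 1). *)
Definition has_law (X : mmspace R) (phi : R -> bspace X) :=
  measurable_fun setT phi /\
  forall B, measurable B -> lam (phi @^-1` B) = mm_P X B.

Lemma has_law_exists (X : mmspace R) : exists phi : R -> bspace X, has_law phi.
Proof. by have [phi h1 h2] := mmspace_lam_image X; exists phi. Qed.

Lemma parameter_has_law (X : mmspace R) (phi : R -> bspace X) :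
  has_law phi -> @parameter R (mm_data X) phi.
Proof.
move=> [mphi hphi] B mB; have {}mB : @measurable _ (bspace X) B by [].
split; last by have := hphi B mB; rewrite /lam.
apply: measurableI; first exact: measurable_I01.
by rewrite -[X in measurable X]setTI; exact: mphi.
Qed.

Lemma has_law_parameter (X : mmspace R) (phi : R -> mm_T X) :
  @parameter R (mm_data X) phi ->
  exists2 phi0 : R -> bspace X, has_law phi0 & forall x, I01 x -> phi0 x = phi x.
Proof.
move=> hphi; pose phi0 (x : R) : bspace X := if x \in @I01 R then phi x else point.
have phi0E x : I01 x -> phi0 x = phi x by move=> Ix; rewrite /phi0 mem_set.
exists phi0 => //; split.
  move=> _ B mB; rewrite setTI.
  have [mI _] := hphi B mB.
  have -> : phi0 @^-1` B = (@I01 R `&` phi @^-1` B) `|`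
      (~` @I01 R `&` [set x | B point]).
    apply/seteqP; split => x /=; rewrite /phi0; case: ifPn => [/set_mem|/negP] Ix.
    - by move=> Bx; left.
    - by move=> Bx; right; split => // /mem_set.
    - by case=> [[_ //]|[//]].
    - by case=> [[/mem_set//]|[//]].
  apply: measurableU => //; apply: measurableI.
    by apply: measurableC; exact: measurable_I01.
  case: (pselect (B point)) => h; first by rewrite (_ : mkset _ = setT) //; apply/seteqP; split.
  by rewrite (_ : mkset _ = set0) //; apply/seteqP; split.
move=> B mB; have [_ /= <-] := hphi B mB; rewrite -/(lam _).
by apply: eq_lam => x Ix /=; rewrite phi0E.
Qed.

Definition square_map (kappa : R -> R * R) := measurable_fun setT kappa /\
  forall B, measurable B -> lam (kappa @^-1` B) = (@lam R \x @lam R)%E B.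

Lemma prod_has_law (X Y : mmspace R) (phi : R -> bspace X) (psi : R -> bspace Y) :
  has_law phi -> has_law psi -> forall B, measurable B ->
  (@lam R \x @lam R)%E ((fun p => (phi p.1, psi p.2)) @^-1` B) =
  (mm_P X \x mm_P Y)%E B.
Proof. by move=> [m1 h1] [m2 h2]; exact: product_image. Qed.

Lemma prod_parameter (F : R -> R -> R) (X Y : mmspace R) kappa
    (phi : R -> bspace X) (psi : R -> bspace Y) : in_F2 F ->
  square_map kappa -> has_law phi -> has_law psi ->
  @parameter R (mmprod F X Y) (fun t => (phi (kappa t).1, psi (kappa t).2)).
Proof.
move=> F2 [mk hk] hphi hpsi B /(measurable_borel_prod F2) mB.
pose Phi (p : R * R) := (phi p.1, psi p.2) : bspace X * bspace Y.
have mPhi : measurable_fun setT Phi.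
  by apply: measurable_fun_pair; apply: measurableT_comp => //; [case: hphi|case: hpsi].
have mPB : measurable (Phi @^-1` B) by rewrite -[X in measurable X]setTI; exact: mPhi.
split; last by have := hk _ mPB; rewrite (prod_has_law hphi hpsi mB).
apply: measurableI; first exact: measurable_I01.
by have := mk measurableT _ mPB; rewrite setTI.
Qed.

Lemma is_metric_mmprod (F : R -> R -> R) (X Y : mmspace R) : in_F2 F ->
  is_metric (@md_d _ (mmprod F X Y)).
Proof. by move=> F2; apply: F2.1; exact: mm_metric. Qed.

Lemma dconc_close (X Y : mmdata R) (phi : R -> md_T X) (psi : R -> md_T Y) (e : R) :
  0 <= e -> parameter phi -> parameter psi ->
  (forall f, Lip1 f -> exists2 g, @Lip1 _ Y g &
    (lam (offby e (f \o phi) (g \o psi)) <= e%:E)%E) ->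
  (forall g, Lip1 g -> exists2 f, @Lip1 _ X f &
    (lam (offby e (f \o phi) (g \o psi)) <= e%:E)%E) ->
  dconc X Y <= e.
Proof.
move=> e0 hphi hpsi h1 h2; apply: (le_trans (dconc_le hphi hpsi)).
apply: hausdorff_le => // [_ [f lf <-]|_ [g lg <-]].
  have [g lg h] := h1 f lf; exists (g \o psi); first by exists g.
  exact: kyfan_le.
have [f lf h] := h2 g lg; exists (f \o phi); first by exists f.
exact: kyfan_le.
Qed.

Lemma close_dconc (X Y : mmdata R) (phi0 : R -> md_T X) (psi0 : R -> md_T Y) (e : R) :
  is_metric (@md_d _ X) -> is_metric (@md_d _ Y) ->
  parameter phi0 -> parameter psi0 -> dconc X Y < e ->
  exists (phi : R -> md_T X) (psi : R -> md_T Y),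
  [/\ parameter phi, parameter psi,
  (forall f, Lip1 f -> exists2 g, @Lip1 _ Y g &
    (lam (offby e (f \o phi) (g \o psi)) <= e%:E)%E) &
  (forall g, Lip1 g -> exists2 f, @Lip1 _ X f &
    (lam (offby e (f \o phi) (g \o psi)) <= e%:E)%E)].
Proof.
move=> mX mY hphi0 hpsi0 /(dconc_lt hphi0 hpsi0)[phi [psi [hphi [hpsi]]]].
have ne (Z : mmdata R) (chi : R -> md_T Z) : is_metric (@md_d _ Z) ->
    pullback_Lip1 chi !=set0.
  move=> [Z0 _]; exists ((fun=> 0) \o chi); exists (fun=> 0) => // x y.
  by rewrite subrr normr0.
move=> /(hausdorff_lt (ne _ _ mX) (ne _ _ mY))[h1 h2].
exists phi, psi; split => // [f lf|g lg].
  have [|_ [g lg <-] h] := h1 (f \o phi); first by exists f.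
  by exists g => //; exact: kyfan_lt.
have [|_ [f lf <-] h] := h2 (g \o psi); first by exists g.
by exists f => //; exact: kyfan_lt.
Qed.

Definition close (e : R) (X' X : mmspace R) (phi : R -> bspace X')
    (psi : R -> bspace X) :=
  (forall f, @Lip1 _ X' f -> exists2 g, @Lip1 _ X g &
    (lam (offby e (f \o phi) (g \o psi)) <= e%:E)%E) /\
  (forall g, @Lip1 _ X g -> exists2 f, @Lip1 _ X' f &
    (lam (offby e (f \o phi) (g \o psi)) <= e%:E)%E).

Lemma concentrates_close (Xs : nat -> mmspace R) (X : mmspace R) (e : R) :
  concentrates (fun n => mm_data (Xs n)) (mm_data X) -> 0 < e ->
  \forall n \near \oo, exists (phi : R -> bspace (Xs n)) (psi : R -> bspace X),
    [/\ has_law phi, has_law psi & close e phi psi].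
Proof.
move=> /cvgrPdist_lt h e0; apply: filterS (h e e0) => n.
rewrite sub0r normrN ger0_norm ?dconc_ge0 // => dn.
have [phi0 /parameter_has_law hphi0] := has_law_exists (Xs n).
have [psi0 /parameter_has_law hpsi0] := has_law_exists X.
have [phi [psi [hphi hpsi h1 h2]]] :=
  @close_dconc (Xs n) X _ _ e (mm_metric (Xs n)) (mm_metric X) hphi0 hpsi0 dn.
have [phi' hphi' Ephi] := has_law_parameter hphi.
have [psi' hpsi' Epsi] := has_law_parameter hpsi.
exists phi', psi'; split => //.
have E f g : lam (offby e (f \o phi') (g \o psi')) = lam (offby e (f \o phi) (g \o psi)).
  by apply: eq_lam => x Ix; rewrite /offby /= Ephi // Epsi.
split=> [f /h1[g lg hg]|g /h2[f lf hf]]; first by exists g; rewrite // E.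
by exists f; rewrite // E.
Qed.

Lemma cvg0_dconc (Xs : nat -> mmdata R) (X : mmdata R) :
  (forall e : R, 0 < e -> \forall n \near \oo, dconc (Xs n) X <= e) ->
  concentrates Xs X.
Proof.
move=> h; apply/cvgrPdist_le => e /h; apply: filterS => n.
by rewrite sub0r normrN ger0_norm // dconc_ge0.
Qed.

End MeasurableProducts.

(** * Lipschitz functions on products *)

Definition sublevel (R : realType) (T : Type) (h : T -> R) (a : R) : set T :=
  [set q | h q <= a].

Definition superlevel (R : realType) (T : Type) (h : T -> R) (a : R) : set T :=
  [set q | a <= h q].

(** * Quantiles and sections *)

Section Quantiles.
Variables (R : realType) (d : measure_display) (T : measurableType d).

Lemma measurable_offby (e : R) (f g : T -> R) :
  measurable_fun setT f -> measurable_fun setT g -> measurable (offby e f g).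
Proof.
move=> mf mg.
have mh : measurable_fun setT (fun x => `|f x - g x|).
  by apply: measurableT_comp => //; exact: measurable_funB.
have -> : offby e f g = (fun x => `|f x - g x|) @^-1` `]e, +oo[%classic.
  by apply/seteqP; split => x; rewrite /offby /= in_itv /= andbT.
by rewrite -[X in measurable X]setTI; exact: mh.
Qed.

Lemma measurable_sublevel (h : T -> R) (a : R) : measurable_fun setT h ->
  measurable (sublevel h a).
Proof.
move=> mh.
have -> : sublevel h a = h @^-1` `]-oo, a]%classic.
  by apply/seteqP; split => x; rewrite /= in_itv.
by rewrite -[X in measurable X]setTI; exact: mh.
Qed.

Variable mu : {measure set T -> \bar R}.

Lemma measure_bigcup_lt_le (N : nat) (A : nat -> set T) (c : R) : 0 <= c ->
  (forall i, measurable (A i)) -> (forall i, (mu (A i) <= c%:E)%E) ->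
  (mu (\bigcup_(i in [set i | (i < N)%N]) A i) <= (N%:R * c)%:E)%E.
Proof.
move=> c0 mA hA; rewrite bigcup_mkord.
elim: N => [|N IH]; first by rewrite big_ord0 measure0 mul0r.
rewrite big_ord_recr /=; apply: (le_trans (measureU2 _ _ _)) => //.
  by apply: bigsetU_measurable => i _.
rewrite -natr1 mulrDl mul1r EFinD; apply: leeD; [exact: IH|exact: hA].
Qed.

(** [B] is the part of [C] where [h] lies below its [c]-quantile [inf S], with a margin of eta / 2
    since the infimum need not be attained. Any other point [p] of [C] can be traded for a subset of
    mass more than [c] where [h] is at most [h p + eta]. *)
Lemma lower_quantile (C : set T) (h : T -> R) (c eta : R) :
  measurable C -> measurable_fun setT h -> 0 <= c -> 0 < eta ->
  exists B : set T, [/\ measurable B, (mu B <= c%:E)%E &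
    forall p, C p -> ~ B p -> (c%:E < mu (C `&` sublevel h (h p + eta)))%E].
Proof.
move=> mC mh c0 eta0.
have mL a : measurable (C `&` sublevel h a).
  by apply: measurableI => //; exact: measurable_sublevel.
pose S := [set a : R | (c%:E < mu (C `&` sublevel h a))%E].
have Sup (a b : R) : S a -> a <= b -> S b.
  move=> Sa ab; apply: (lt_le_trans Sa); apply: le_measure; rewrite ?inE //.
  by move=> q /= [Cq qa]; split => //; exact: le_trans ab.
have [S0|/set0P ne] := eqVneq S set0.
  (* No sublevel set has mass above [c]; they exhaust [C], so [C] has mass at most [c] and is
     discarded as a whole. *)
  exists C; split => //.
  have -> : C = \bigcup_n (C `&` sublevel h n%:R).
    rewrite -setI_bigcupr; apply/seteqP; split => [q Cq|q []//]; split => //.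
    exists (Num.truncn `|h q|).+1 => //=.
    by apply: (le_trans (ler_norm _)); apply/ltW; exact: truncnS_gt.
  have cv := @nondecreasing_cvg_mu _ _ _ mu (fun n => C `&` sublevel h n%:R)
    (fun n => mL n%:R) (bigcupT_measurable _ (fun n => mL n%:R)).
  have hm : {homo (fun n : nat => C `&` sublevel h n%:R) :
      n m / (n <= m)%N >-> (n <= m)%O}.
    move=> m n mn; rewrite subsetEset => q /= [Cq qm]; split => //.
    by apply: (le_trans qm); rewrite ler_nat.
  move: cv => /(_ hm) cv; rewrite -(cvg_lim _ cv) //; apply: lime_le.
    by apply/cvg_ex; eexists; exact: cv.
  apply: nearW => n /=; rewrite leNgt; apply/negP => Sn.
  by have : S n%:R by []; rewrite S0.
have [[l lS]|nlb] := pselect (has_lbound S).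
  exists (C `&` sublevel h (inf S - eta / 2)); split => //.
    rewrite leNgt; apply/negP => Si.
    have : inf S <= inf S - eta / 2 by apply: ge_inf => //; exists l.
    by lra.
  move=> p Cp nBp.
  have hp : inf S - eta / 2 < h p by rewrite ltNge; apply/negP => hp; apply: nBp.
  have eta20 : 0 < eta / 2 by lra.
  have [|a Sa ha] := @inf_adherent _ S _ eta20; first by split => //; exists l.
  by apply: (Sup a) => //; lra.
exists set0; split => //; first by rewrite measure0 lee_fin.
move=> p Cp _.
have [a Sa ha] : exists2 a, S a & a < h p.
  apply: contrapT => hn; apply: nlb; exists (h p) => a Sa.
  by rewrite leNgt; apply/negP => ha; apply: hn; exists a.
by apply: (Sup a) => //; lra.
Qed.

Lemma two_sided_quantile (C : set T) (h : T -> R) (c eta : R) :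
  measurable C -> measurable_fun setT h -> 0 <= c -> 0 < eta ->
  exists B : set T, [/\ measurable B, (mu B <= (2 * c)%:E)%E &
    forall p, C p -> ~ B p ->
      (c%:E < mu (C `&` sublevel h (h p + eta)))%E /\
      (c%:E < mu (C `&` superlevel h (h p - eta)))%E].
Proof.
move=> mC mh c0 eta0.
have [B1 [mB1 h1 B1P]] := lower_quantile mC mh c0 eta0.
have mh' : measurable_fun setT (fun x => - h x).
  exact: (measurableT_comp (@oppr_measurable R setT)).
have [B2 [mB2 h2 B2P]] := lower_quantile mC mh' c0 eta0.
exists (B1 `|` B2); split; first exact: measurableU.
  apply: (le_trans (measureU2 _ mB1 mB2)).
  by rewrite mulr2n mulrDl mul1r EFinD; apply: leeD.
move=> p Cp /not_orP[nB1 nB2]; split; first exact: B1P.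
have := B2P p Cp nB2; congr (_ < mu (_ `&` _))%E.
by apply/seteqP; split => q; rewrite /sublevel /superlevel /=; lra.
Qed.

End Quantiles.

Section Sections.
Variable R : realType.

Definition lam2 : set (R * R) -> \bar R := (@lam R \x @lam R)%E.
HB.instance Definition _ := Probability.on lam2.

Lemma lam2_cylinder1 (U : set R) : measurable U -> lam2 (U `*` setT) = lam U.
Proof.
move=> mU; transitivity (lam U * lam [set: R])%E; first exact: product_measure1E.
by rewrite lam_setT mule1.
Qed.

Lemma lam2_cylinder2 (U : set R) : measurable U -> lam2 (setT `*` U) = lam U.
Proof.
move=> mU; transitivity (lam [set: R] * lam U)%E; first exact: product_measure1E.
by rewrite lam_setT mul1e.
Qed.

(** A section has mass at most 1 over the set of large sections and at most [c] elsewhere, so by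
    Fubini the mass of [P] is at most [c] plus the mass of that set. *)
Lemma large_sections (P : set (R * R)) (c : R) : measurable P -> 0 <= c ->
  ((2 * c)%:E < lam2 P)%E ->
  (c%:E < lam [set s | (c%:E < lam (xsection P s))%E])%E.
Proof.
move=> mP c0; rewrite ltNge => /negP hP; rewrite ltNge; apply/negP => hT.
apply: hP; pose S := [set s | (c%:E < lam (xsection P s))%E].
have mX := @measurable_fun_xsection _ _ _ _ R (@lam R) _ mP.
have mS : measurable S.
  have -> : S = ((@lam R \o xsection P) @^-1` `]c%:E, +oo[%classic).
    by apply/seteqP; split => s; rewrite /S /= in_itv /= andbT.
  by rewrite -[X in measurable X]setTI; apply: mX => //; exact: emeasurable_itv.
have le1 : (lam2 P <= \int[@lam R]_s ((\1_S s)%:E + c%:E))%E.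
  apply: ge0_le_integral => //.
  - by apply: emeasurable_funD => //; apply/measurable_EFinP.
  - move=> s _ /=; rewrite indicE; case: (boolP (s \in S)) => [_|].
      by apply: (le_trans (lam_le1 _)); rewrite /= -EFinD lee_fin lerDl.
    by move=> /negP nS; rewrite /= add0e leNgt; apply/negP => sS; apply/nS/mem_set.
apply: (le_trans le1); rewrite ge0_integralD //; last exact/measurable_EFinP.
rewrite integral_indic // setIT integral_cst // [X in (_ * X)%E](_ : _ = 1%E) ?mule1; last exact: lam_setT.
by rewrite mulr2n mulrDl mul1r EFinD; apply: leeD.
Qed.

End Sections.

(** * Distances seen through close parameters *)

Section DistanceEstimates.
Variable R : realType.
Implicit Types (X : mmspace R).

Lemma metric_lip (T : Type) (d : T -> T -> R) (x y z : T) : is_metric d ->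
  `|d x y - d x z| <= d y z.
Proof.
move=> [_ [_ [dC dT]]]; rewrite ler_norml; have := dT x y z; have := dT x z y.
by rewrite (dC z y); lra.
Qed.

Lemma dist_lip X (x : mm_T X) : @Lip1 _ X (mdist X x).
Proof. by move=> y z; apply: metric_lip; exact: mm_metric. Qed.

Lemma measurable_lip_comp X (phi : R -> bspace X) (f : mm_T X -> R) :
  measurable_fun setT phi -> @Lip1 _ X f -> measurable_fun setT (f \o phi).
Proof.
move=> mphi lf; apply: (@measurableT_comp _ _ _ _ (bspace X)) => //.
by apply: (@measurable_lip R _ (bspace X) (mdist X) f) => //; exact: measurable_open_bspace.
Qed.

Lemma measurable_ball_preimage X (phi : R -> bspace X) (x : mm_T X) (r : R) :
  measurable_fun setT phi -> measurable [set s | mdist X x (phi s) < r].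
Proof.
move=> mphi; rewrite (_ : mkset _ = setT `&` phi @^-1` [set y | mdist X x y < r]).
  apply: mphi => //; apply: measurable_open_bspace; apply: metric_open_ball.
  exact: mm_metric.
by rewrite setTI.
Qed.

(* Testing closeness on the distances to finitely many centers. *)
Lemma dist_lower_bound (X' X : mmspace R) (phi : R -> bspace X')
    (psi : R -> bspace X) (e delta : R) (x : nat -> mm_T X) (N : nat) :
  measurable_fun setT phi -> measurable_fun setT psi -> close e phi psi ->
  exists A : set R, [/\ measurable A, (lam (~` A) <= (N%:R * e)%:E)%E &
    forall i s s', (i < N)%N -> A s -> A s' -> mdist X (x i) (psi s) < delta ->
    mdist X (psi s) (psi s') <= mdist X' (phi s) (phi s') + 2 * e + 2 * delta].
Proof.
move=> mphi mpsi [_ cl]; elim: N => [|N [A [mA hA AP]]].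
  by exists setT; split => //; rewrite setCT measure0 mul0r.
have [f lf hf] := cl _ (dist_lip (x N)).
exists (A `\` offby e (f \o phi) (mdist X (x N) \o psi)); split.
- apply: measurableD => //; apply: measurable_offby.
    exact: measurable_lip_comp.
  by apply: measurable_lip_comp => //; exact: dist_lip.
- rewrite setCD; apply: (le_trans (lamU2 _ _)).
  rewrite -natr1 mulrDl mul1r EFinD; apply: leeD; first exact: hA.
  exact: hf.
move=> i s s'; rewrite ltnS leq_eqVlt => /predU1P[->|iN]; last first.
  by move=> [As _] [As' _]; exact: AP iN As As'.
move=> [_ ns] [_ ns'] xs.
have [_ [_ [dC dT]]] := mm_metric X.
(* Since [psi s] is within [delta] of the center, its distance to [psi s'] exceeds the difference of
   their distances to the center by at most [2 * delta]; that difference is copied by [f] up to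
   [2 * e]. *)
have h1 : `|f (phi s) - mdist X (x N) (psi s)| <= e by rewrite leNgt; apply/negP.
have h2 : `|f (phi s') - mdist X (x N) (psi s')| <= e by rewrite leNgt; apply/negP.
have h3 := lf (phi s) (phi s'); have h4 := dT (psi s) (x N) (psi s').
rewrite (dC (psi s) (x N)) in h4; move: h1 h2 h3; rewrite !ler_norml /= => h1 h2 h3.
move: (mdist X' (phi s) (phi s')) (mdist X (psi s) (psi s')) h3 h4 => D1 D2.
move: (mdist X (x N) (psi s)) xs h1 (mdist X (x N) (psi s')) h2 => D3 xs h1 D4 h2.
move: (f (phi s)) (f (phi s')) h1 h2 => f1 f2 h1 h2 h3 h4.
by clear -h1 h2 h3 h4 xs; lra.
Qed.

(* Testing closeness on the distance to the image of [U]. *)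
Lemma dist_upper_bound (X' X : mmspace R) (phi : R -> bspace X')
    (psi : R -> bspace X) (e D : R) (U V : set R) :
  0 < e -> close e phi psi -> (e%:E < lam U)%E -> (e%:E < lam V)%E ->
  (forall u v, U u -> V v -> mdist X (psi u) (psi v) <= D) ->
  exists u v, [/\ U u, V v & mdist X' (phi u) (phi v) < D + 3 * e].
Proof.
move=> e0 [cl _] hU hV UVD.
have [d_ge0 [d0 [dC dT]]] := mm_metric X'.
pose E y := [set mdist X' (phi u) y | u in U].
have E_ge0 y z : E y z -> 0 <= z by move=> [u _ <-].
have avoid (W S : set R) : (lam S <= e%:E)%E -> (e%:E < lam W)%E ->
    exists2 w, W w & ~ S w.
  move=> hS hW; apply: contrapT => h.
  have : W `<=` S by move=> w Ww; apply: contrapT => nS; apply: h; exists w.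
  move=> /le_lam WS; have := lt_le_trans hW (le_trans WS hS).
  by rewrite ltxx.
have [u0 Uu0 _] := avoid U set0 ltac:(by rewrite measure0 lee_fin ltW) hU.
have E0 y : E y !=set0 by exists (mdist X' (phi u0) y), u0.
pose f y := inf (E y).
have lf : @Lip1 _ X' f.
  have half y z : f y - f z <= mdist X' y z.
    rewrite lerBlDr -lerBlDl; apply: lb_le_inf => // _ [u Uu <-].
    rewrite lerBlDl; apply: (@le_trans _ _ (mdist X' (phi u) y)).
      by apply: inf_le_mem; [exact: E_ge0|exists u].
    by have := dT (phi u) z y; rewrite (dC z y); lra.
  by move=> y z /=; rewrite ler_norml; have := half y z; have := half z y; rewrite dC; lra.
have [g lg hg] := cl f lf.
(* Both sets have more mass than the exceptional set. Going from [phi u1], where [f] vanishes,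
   through [g] to [phi v] costs [e] twice and [D] once; a third [e] gives a strict inequality, so
   that the infimum [f (phi v)] is nearly attained by a point of [U]. *)
have [u1 Uu1 nu1] := avoid _ _ hg hU; have [v Vv nv] := avoid _ _ hg hV.
have h1 : `|f (phi u1) - g (psi u1)| <= e by rewrite leNgt; apply/negP.
have h2 : `|f (phi v) - g (psi v)| <= e by rewrite leNgt; apply/negP.
have h3 := lg (psi v) (psi u1); have h4 := UVD u1 v Uu1 Vv.
have h5 : f (phi u1) <= 0.
  have <- : mdist X' (phi u1) (phi u1) = 0 by apply/d0.
  by apply: inf_le_mem; [exact: E_ge0|exists u1].
have h6 : f (phi v) < D + 3 * e.
  move: h1 h2 h3; rewrite !ler_norml /=.
  have [_ [_ [dC' _]]] := mm_metric X; rewrite (dC' (psi v)).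
  by move: h4 h5; clear -e0; clearbody f => *; lra.
have [_ [u Uu <-] h] := inf_lt_mem (E_ge0 (phi v)) (E0 _) h6.
by exists u, v.
Qed.

(** Balls around a dense sequence exhaust [X], so finitely many carry almost all the mass. Centers
    and number depend on [X] alone and serve every [psi] with its law; thus [N] is known before the
    closeness [e] has to be chosen. *)
Lemma finite_ball_cover X (delta eta : R) : 0 < delta -> 0 < eta ->
  exists (x : nat -> mm_T X) (N : nat), forall psi : R -> bspace X, has_law psi ->
    (lam (~` \bigcup_(i in [set i | (i < N)%N]) [set s | (mdist X (x i) (psi s) < delta)%R])
      <= eta%:E)%E.
Proof.
move=> delta0 eta0; have [x xP] := mm_separable X.
have [_ [_ [dC _]]] := mm_metric X.
pose B i : set (bspace X) := [set y | mdist X (x i) y < delta].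
have mB i : measurable (B i).
  by apply: measurable_open_bspace; apply: metric_open_ball; exact: mm_metric.
pose C n := \bigcup_(i in [set i | (i < n)%N]) B i.
have mC n : measurable (C n) by apply: bigcup_measurable => i _.
have hm : {homo C : n m / (n <= m)%N >-> (n <= m)%O}.
  move=> m n mn; rewrite subsetEset => y [i im Bi]; exists i => //=.
  exact: leq_trans mn.
have CT : \bigcup_n C n = setT.
  apply/seteqP; split => // y _; have [i yi] := xP y delta delta0.
  by exists i.+1 => //; exists i => //=; rewrite /B /= dC.
have P1 : mm_P X (\bigcup_n C n) = 1%E by rewrite CT; exact: probability_setT.
have cv : mm_P X (C n) @[n --> \oo] --> 1%E.
  rewrite -P1.
  exact: (@nondecreasing_cvg_mu _ _ _ (mm_P X) C mC (bigcupT_measurable _ mC) hm).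
have : \forall n \near \oo, ((1 - eta)%:E < mm_P X (C n))%E.
  have lt1 : ((1 - eta)%:E < 1%:E :> \bar R)%E by rewrite lte_fin; lra.
  apply: (cv [set y | ((1 - eta)%:E < y)%E]).
  apply: open_nbhs_nbhs; split => //; exact: open_ereal_gt_ereal.
move=> [N _ /(_ N (leqnn N)) /= hN].
exists x, N => psi [mpsi hpsi].
apply: (@le_trans _ _ (mm_P X (~` C N))).
  by rewrite -(hpsi _ (measurableC (mC N))).
have -> : mm_P X (~` C N) = (1 - mm_P X (C N))%E by exact: probability_setC.
have fC : mm_P X (C N) \is a fin_num by exact: fin_num_measure.
move: hN; rewrite -(fineK fC) -EFinB lte_fin lee_fin; lra.
Qed.

End DistanceEstimates.

(** * Cells around finitely many centers *)

Section Cells.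
Variable R : realType.

(** The cells may overlap. The lower bound on distances in [X'] holds for all pairs of points, the
    upper bound only for some pair inside any two subsets of mass above [e]. *)
Definition cell_system (X' X : mmspace R) (phi : R -> bspace X') (psi : R -> bspace X)
    (e delta rho eta : R) (x : nat -> mm_T X) (N : nat) (U : nat -> set R) :=
  [/\ forall i, measurable (U i),
      (lam (~` \bigcup_(i in [set i | (i < N)%N]) U i) <= (2 * eta)%:E)%E,
      forall i s, U i s -> mdist X (x i) (psi s) < delta,
      forall i k s s', (i < N)%N -> U i s -> U k s' ->
        mdist X (x i) (x k) <= mdist X' (phi s) (phi s') + rho &
      forall i k (P Q : set R), (i < N)%N -> P `<=` U i -> Q `<=` U k ->
        (e%:E < lam P)%E -> (e%:E < lam Q)%E ->
        exists u v, [/\ P u, Q v &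
          `|mdist X' (phi u) (phi v) - mdist X (x i) (x k)| <= rho]].

(** The lower estimate costs [4 * delta + 2 * e], the upper one [2 * delta + 3 * e]. The uncovered
    mass is at most [N%:R * e] from the [N] tests plus [eta] from the cover. *)
Lemma cell_system_exists (X' X : mmspace R) (phi : R -> bspace X')
    (psi : R -> bspace X) (e delta rho eta : R) (x : nat -> mm_T X) (N : nat) :
  0 < e -> 0 < delta -> 4 * delta + 3 * e <= rho -> N%:R * e <= eta ->
  measurable_fun setT phi -> measurable_fun setT psi -> close e phi psi ->
  (lam (~` \bigcup_(i in [set i | (i < N)%N]) [set s | (mdist X (x i) (psi s) < delta)%R])
      <= eta%:E)%E ->
  exists U, cell_system phi psi e delta rho eta x N U.
Proof.
move=> e0 delta0 rhoP Ne mphi mpsi cl cov.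
have [_ [_ [dC dT]]] := mm_metric X.
have [A [mA hA AP]] := dist_lower_bound delta x N mphi mpsi cl.
exists (fun i => A `&` [set s | mdist X (x i) (psi s) < delta]).
have near_centers i k s s' : mdist X (x i) (psi s) < delta ->
    mdist X (x k) (psi s') < delta ->
    `|mdist X (psi s) (psi s') - mdist X (x i) (x k)| <= 2 * delta.
  move=> h1 h2; rewrite ler_norml.
  have := dT (psi s) (x i) (psi s'); have := dT (x i) (x k) (psi s').
  have := dT (x i) (psi s) (x k); have := dT (psi s) (psi s') (x k).
  rewrite (dC (psi s) (x i)) (dC (psi s') (x k)).
  move: h1 h2; clear.
  move: (mdist X (x i) (psi s)) (mdist X (x k) (psi s')) (mdist X (psi s) (psi s'))
    (mdist X (x i) (x k)) (mdist X (psi s) (x k)) (mdist X (x i) (psi s')).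
  by move=> *; lra.
have lowd i k s s' : (i < N)%N -> A s -> A s' -> mdist X (x i) (psi s) < delta ->
    mdist X (x k) (psi s') < delta ->
    mdist X (x i) (x k) <= mdist X' (phi s) (phi s') + rho.
  move=> iN As As' h1 h2; have := AP i s s' iN As As' h1.
  have := near_centers i k s s' h1 h2; rewrite ler_norml; move: rhoP e0; clear.
  move: (mdist X (psi s) (psi s')) (mdist X (x i) (x k)) (mdist X' (phi s) (phi s')).
  by move=> *; lra.
split.
- by move=> i; apply: measurableI => //; exact: measurable_ball_preimage.
- apply: (@le_trans _ _ (lam (~` A `|` ~` \bigcup_(i in [set i | (i < N)%N])
      [set s | (mdist X (x i) (psi s) < delta)%R]))).
    by apply: le_lam; rewrite -setI_bigcupr setCI.
  apply: (le_trans (lamU2 _ _)); rewrite mulr2n mulrDl mul1r EFinD; apply: leeD => //.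
  by apply: (le_trans hA); rewrite lee_fin.
- by move=> i s [].
- by move=> i k s s' iN [As h1] [As' h2]; exact: lowd.
move=> i k P Q iN PU QU hP hQ.
have [|u [v [Pu Qv huv]]] := @dist_upper_bound R X' X phi psi e
    (mdist X (x i) (x k) + 2 * delta) P Q e0 cl hP hQ.
  move=> u v /PU[_ h1] /QU[_ h2]; have := near_centers i k u v h1 h2.
  rewrite ler_norml; move: (mdist X _ _) (mdist X _ _) => *; lra.
exists u, v; split => //; have [Au h1] := PU _ Pu; have [Av h2] := QU _ Qv.
have := lowd i k u v iN Au Av h1 h2; rewrite ler_norml.
move: huv rhoP delta0; clear.
by move: (mdist X' (phi u) (phi v)) (mdist X (x i) (x k)) => *; lra.
Qed.

Lemma measurable_lip_prod (G : R -> R -> R) (Z W : mmspace R) (chi : R -> bspace Z)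
  (xi : R -> bspace W) (f : mm_T Z * mm_T W -> R) : in_F2 G ->
  measurable_fun setT chi -> measurable_fun setT xi -> @Lip1 _ (mmprod G Z W) f ->
  measurable_fun setT (fun p : R * R => f (chi p.1, xi p.2)).
Proof.
move=> G2 mchi mxi lf.
apply: (@measurableT_comp _ _ _ _ (bspace Z * bspace W)%type R f).
  apply: (@measurable_lip R _ (bspace Z * bspace W)%type _ f _ lf).
  exact: measurable_open_prod.
by apply: measurable_fun_pair; apply: measurableT_comp.
Qed.

End Cells.

Section ProductCells.
Variables (R : realType) (X' X Y' Y : mmspace R).
Variables (phi : R -> bspace X') (psi : R -> bspace X).
Variables (phi' : R -> bspace Y') (psi' : R -> bspace Y).
Variables (e delta rho eta : R) (x : nat -> mm_T X) (N : nat)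
  (y : nat -> mm_T Y) (M : nat) (U V : nat -> set R) (F' F : R -> R -> R).
Hypotheses (mphi : measurable_fun setT phi) (mpsi : measurable_fun setT psi).
Hypotheses (mphi' : measurable_fun setT phi') (mpsi' : measurable_fun setT psi').
Hypotheses (UP : cell_system phi psi e delta rho eta x N U).
Hypotheses (VP : cell_system phi' psi' e delta rho eta y M V).
Hypotheses (F2' : in_F2 F') (F2 : in_F2 F).
Hypotheses (e0 : 0 < e) (eta0 : 0 < eta) (delta_rho : 2 * delta <= rho).
Hypothesis NMe : N%:R * (M%:R * (4 * e)) <= eta.
Hypothesis FP : forall a b a' b', 0 <= a -> 0 <= b -> 0 <= a' -> 0 <= b' ->
  `|a' - a| <= rho -> `|b' - b| <= rho -> F a' b' <= F a b + eta.

Let dX_ge0 (Z : mmspace R) p q : 0 <= mdist Z p q.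
Proof. by have [+ _] := mm_metric Z; exact. Qed.

Let center_dist (Z : mmspace R) (z : nat -> mm_T Z) p q i k :
  mdist Z (z i) p < delta -> mdist Z (z k) q < delta ->
  `|mdist Z (z i) (z k) - mdist Z p q| <= rho.
Proof.
have [_ [_ [dC dT]]] := mm_metric Z.
move=> h1 h2; rewrite ler_norml.
have := dT p (z i) q; have := dT (z i) (z k) q.
have := dT (z i) p (z k); have := dT p q (z k).
rewrite (dC p (z i)) (dC q (z k)).
have := delta_rho; move: h1 h2.
move: (mdist Z (z i) p) (mdist Z (z k) q) (mdist Z p q) (mdist Z (z i) (z k))
  (mdist Z p (z k)) (mdist Z (z i) q).
by move=> *; have := e0; have := eta0; lra.
Qed.

Let coverC := ~` \bigcup_(i in [set i | (i < N)%N]) U i.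
Let coverC' := ~` \bigcup_(j in [set j | (j < M)%N]) V j.

Let mcoverC : measurable coverC.
Proof. by case: UP => mU *; apply: measurableC; apply: bigcup_measurable. Qed.

Let mcoverC' : measurable coverC'.
Proof. by case: VP => mV *; apply: measurableC; apply: bigcup_measurable. Qed.

Let outside := (coverC `*` setT) `|` (setT `*` coverC').

Let moutside : measurable outside.
Proof. by apply: measurableU; exact: measurableX. Qed.

Let outside_le : (lam2 outside <= (4 * eta)%:E)%E.
Proof.
apply: (le_trans (measureU2 _ _ _)); [exact: measurableX..|].
have -> : 4 * eta = 2 * eta + 2 * eta by ring.
rewrite EFinD; apply: leeD.
  by case: UP => _ h *; rewrite [X in (X <= _)%E](lam2_cylinder1 mcoverC).
by case: VP => _ h *; rewrite [X in (X <= _)%E](lam2_cylinder2 mcoverC').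
Qed.

Let in_cell p : ~ outside p -> exists i j, [/\ (i < N)%N, (j < M)%N, U i p.1 & V j p.2].
Proof.
move=> /not_orP[h1 h2].
have [i iN Ui] : (\bigcup_(i in [set i | (i < N)%N]) U i) p.1.
  by apply: contrapT => h; apply: h1.
have [j jM Vj] : (\bigcup_(j in [set j | (j < M)%N]) V j) p.2.
  by apply: contrapT => h; apply: h2.
by exists i, j.
Qed.

(* Slice first in the first coordinate, then in the second. *)
Let cell_pair i j k l (P Q : set (R * R)) : (i < N)%N -> (j < M)%N ->
  measurable P -> measurable Q -> P `<=` U i `*` V j -> Q `<=` U k `*` V l ->
  ((2 * e)%:E < lam2 P)%E -> ((2 * e)%:E < lam2 Q)%E ->
  exists p q, [/\ P p, Q q,
    `|mdist X' (phi p.1) (phi q.1) - mdist X (x i) (x k)| <= rho &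
    `|mdist Y' (phi' p.2) (phi' q.2) - mdist Y (y j) (y l)| <= rho].
Proof.
move=> iN jM mP mQ PUV QUV /(large_sections mP (ltW e0)) hP
  /(large_sections mQ (ltW e0)) hQ.
have ne (S : set (R * R)) s : (e%:E < lam (xsection S s))%E -> exists t, S (s, t).
  move=> h; apply: contrapT => hn.
  have S0 : xsection S s `<=` set0.
    by move=> t; rewrite /xsection /= inE => Ht; apply: hn; exists t.
  have := lt_le_trans h (le_lam S0); rewrite measure0 lte_fin.
  by rewrite ltNge (ltW e0).
case: UP => _ _ _ _ Upair; case: VP => _ _ _ _ Vpair.
have [||s [s' [hs hs' ds]]] := Upair i k _ _ iN _ _ hP hQ.
- by move=> s /= /ne[t /PUV[]].
- by move=> s /= /ne[t /QUV[]].
have [||t [t' [ht ht' dt]]] := Vpair j l _ _ jM _ _ hs hs'.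
- by move=> t; rewrite /xsection /= inE => /PUV[].
- by move=> t; rewrite /xsection /= inE => /QUV[].
exists (s, t), (s', t'); split => //.
- by move: ht; rewrite /xsection /= inE.
- by move: ht'; rewrite /xsection /= inE.
Qed.

(** To compare [f] at [p] and [q], quantiles yield sets of mass above [2 * e] in their cells, where
    [f] is at least [f] at [p] minus [eta], respectively at most [f] at [q] plus [eta]; [cell_pair]
    finds in them points at nearly the distances of the centers. The error [4 * eta] consists of two
    quantile errors, the passage from [F'] to [F], and that from the centers to the actual
    points. *)
Lemma prod_close_down :
  (forall i k j l, (i < N)%N -> (k < N)%N -> (j < M)%N -> (l < M)%N ->
    forall a' b', 0 <= a' -> 0 <= b' ->
    `|a' - mdist X (x i) (x k)| <= rho -> `|b' - mdist Y (y j) (y l)| <= rho ->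
    F' a' b' <= F (mdist X (x i) (x k)) (mdist Y (y j) (y l)) + eta) ->
  forall f, @Lip1 _ (mmprod F' X' Y') f -> exists2 g, @Lip1 _ (mmprod F X Y) g &
    (lam2 (offby (6 * eta) (fun p => f (phi p.1, phi' p.2))
                           (fun p => g (psi p.1, psi' p.2))) <= (6 * eta)%:E)%E.
Proof.
move=> HB f lf.
pose h (p : R * R) := f (phi p.1, phi' p.2).
have mh : measurable_fun setT h by exact: measurable_lip_prod lf.
pose C (ij : nat * nat) := U ij.1 `*` V ij.2.
have mC ij : measurable (C ij).
  by case: UP => mU *; case: VP => mV *; exact: measurableX.
have e20 : 0 <= 2 * e by have := e0; have := eta0; lra.
have [B BP] := choice (fun ij => @two_sided_quantile R _ _ (@lam2 R) (C ij) h _ eta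
  (mC ij) mh e20 eta0).
have mB ij : measurable (B ij) by case: (BP ij).
pose G := [set p | exists i j, [/\ (i < N)%N, (j < M)%N, C (i, j) p & ~ B (i, j) p]].
pose dF := @md_d _ (mmprod F X Y).
have Gh p q : G p -> G q ->
    h p - h q <= dF (psi p.1, psi' p.2) (psi q.1, psi' q.2) + 4 * eta.
  move=> [i [j [iN jM Cp nBp]]] [k [l [kN lM Cq nBq]]].
  have [_ _ /(_ p Cp nBp)[_ hp]] := BP (i, j).
  have [_ _ /(_ q Cq nBq)[hq _]] := BP (k, l).
  have mP : measurable (C (i, j) `&` superlevel h (h p - eta)).
    apply: measurableI => //; rewrite /superlevel.
    have -> : [set q0 | h p - eta <= h q0] = h @^-1` `[h p - eta, +oo[%classic.
      by apply/seteqP; split => z; rewrite /= in_itv /= andbT.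
    by rewrite -[X in measurable X]setTI; exact: mh.
  have mQ : measurable (C (k, l) `&` sublevel h (h q + eta)).
    by apply: measurableI => //; exact: measurable_sublevel.
  have sP : C (i, j) `&` superlevel h (h p - eta) `<=` U i `*` V j by move=> z [].
  have sQ : C (k, l) `&` sublevel h (h q + eta) `<=` U k `*` V l by move=> z [].
  have [p' [q' [[Cp' hp'] [Cq' hq'] dx dy]]] := cell_pair iN jM mP mQ sP sQ hp hq.
  have h1 := lf (phi p'.1, phi' p'.2) (phi q'.1, phi' q'.2).
  have h2 := HB i k j l iN kN jM lM _ _ (dX_ge0 _ _) (dX_ge0 _ _) dx dy.
  have [_ _ Uc _ _] := UP; have [_ _ Vc _ _] := VP.
  have h3 := FP (dX_ge0 _ _) (dX_ge0 _ _) (dX_ge0 _ _) (dX_ge0 _ _)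
    (center_dist (Uc _ _ Cp.1) (Uc _ _ Cq.1)) (center_dist (Vc _ _ Cp.2) (Vc _ _ Cq.2)).
  move: h1 h2 h3 hp' hq'; rewrite /superlevel /sublevel /dF /= ler_norml -!/(h _).
  move: (h p) (h q) (h p') (h q') (F _ _) (F _ _) (F' _ _) => *; have := e0; have := eta0; lra.
have eta4 : 0 <= 4 * eta by have := e0; have := eta0; lra.
have [g lg gP] := mcshane (is_metric_mmprod X Y F2) eta4 Gh.
exists g => //.
have mg : measurable_fun setT (fun p : R * R => g (psi p.1, psi' p.2)).
  exact: measurable_lip_prod lg.
(* Each of the [N * M] cells discards mass at most [4 * e]: quantiles at level [2 * e], on both
   sides. *)
pose BB := \bigcup_(i in [set i | (i < N)%N]) \bigcup_(j in [set j | (j < M)%N]) B (i, j).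
have mBi i : measurable (\bigcup_(j in [set j | (j < M)%N]) B (i, j)).
  by apply: bigcup_measurable => j _.
have BBle : (lam2 BB <= eta%:E)%E.
  apply: (@le_trans _ _ (N%:R * (M%:R * (4 * e)))%:E); last by rewrite lee_fin.
  apply: measure_bigcup_lt_le => // [|i].
    by rewrite mulr_ge0 //; have := e0; lra.
  apply: measure_bigcup_lt_le => // [|j]; first by have := e0; have := eta0; lra.
  have [_ + _] := BP (i, j); rewrite mulrA (_ : 2 * 2 = 4 :> R) //; ring.
apply: (@le_trans _ _ (lam2 (outside `|` BB))).
  apply: le_measure; rewrite ?inE.
  - exact: measurable_offby.
  - by apply: measurableU => //; apply: bigcup_measurable => i _.
  move=> p hp; apply: contrapT => /not_orP[np nB].
  have [i [j [iN jM Ui Vj]]] := in_cell np.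
  have Gp : G p.
    by exists i, j; split => // Bp; apply: nB; exists i => //; exists j.
  move: hp (gP p Gp) eta0; rewrite /offby /= distrC -/(h p) => hp hp' eta0'.
  by have := lt_le_trans hp hp'; have := e0; have := eta0; lra.
apply: (le_trans (measureU2 _ _ _)) => //.
  by apply: bigcup_measurable => i _.
apply: (@le_trans _ _ ((4 * eta)%:E + eta%:E)%E); first exact: leeD.
by rewrite -EFinD lee_fin; have := e0; have := eta0; lra.
Qed.

(** The lower bound on distances is pointwise on cells, so no point has to be traded: the error is
    one [eta] from [HA] and one from [FP], and only [outside] is lost. *)
Lemma prod_close_up :
  (forall i k j l, (i < N)%N -> (k < N)%N -> (j < M)%N -> (l < M)%N ->
    forall a' b', 0 <= a' -> 0 <= b' ->
    mdist X (x i) (x k) - rho <= a' -> mdist Y (y j) (y l) - rho <= b' ->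
    F (mdist X (x i) (x k)) (mdist Y (y j) (y l)) <= F' a' b' + eta) ->
  forall g, @Lip1 _ (mmprod F X Y) g -> exists2 f, @Lip1 _ (mmprod F' X' Y') f &
    (lam2 (offby (6 * eta) (fun p => f (phi p.1, phi' p.2))
                           (fun p => g (psi p.1, psi' p.2))) <= (6 * eta)%:E)%E.
Proof.
move=> HA g lg.
pose h (p : R * R) := g (psi p.1, psi' p.2).
have mh : measurable_fun setT h by exact: measurable_lip_prod lg.
pose dF := @md_d _ (mmprod F' X' Y').
have Gh p q : (~` outside) p -> (~` outside) q ->
    h p - h q <= dF (phi p.1, phi' p.2) (phi q.1, phi' q.2) + 2 * eta.
  move=> /in_cell[i [j [iN jM Ui Vj]]] /in_cell[k [l [kN lM Uk Vl]]].
  have h1 := lg (psi p.1, psi' p.2) (psi q.1, psi' q.2).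
  have [_ _ Uc Ulow _] := UP; have [_ _ Vc Vlow _] := VP.
  have a1 := Ulow _ _ _ _ iN Ui Uk; have b1 := Vlow _ _ _ _ jM Vj Vl.
  rewrite -lerBlDr in a1; rewrite -lerBlDr in b1.
  have h2 := HA i k j l iN kN jM lM _ _ (dX_ge0 _ _) (dX_ge0 _ _) a1 b1.
  have cx := center_dist (Uc _ _ Ui) (Uc _ _ Uk).
  have cy := center_dist (Vc _ _ Vj) (Vc _ _ Vl).
  rewrite distrC in cx; rewrite distrC in cy.
  have h3 := FP (dX_ge0 _ _) (dX_ge0 _ _) (dX_ge0 _ _) (dX_ge0 _ _) cx cy.
  move: h1 h2 h3; rewrite /dF /= ler_norml -!/(h _).
  by move: (h p) (h q) (F _ _) (F _ _) (F' _ _) => *; have := e0; have := eta0; lra.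
have eta2 : 0 <= 2 * eta by have := e0; have := eta0; lra.
have [f lf fP] := mcshane (is_metric_mmprod X' Y' F2') eta2 Gh.
exists f => //.
have mf : measurable_fun setT (fun p : R * R => f (phi p.1, phi' p.2)).
  exact: measurable_lip_prod lf.
apply: (@le_trans _ _ (lam2 outside)); last first.
  by apply: (le_trans outside_le); rewrite lee_fin; have := e0; have := eta0; lra.
apply: le_measure; rewrite ?inE //; first exact: measurable_offby.
move=> p hp; apply: contrapT => np.
move: hp (fP p np) eta0; rewrite /offby /= -/(h p) => hp hp' eta0'.
by have := lt_le_trans hp hp'; have := e0; have := eta0; lra.
Qed.

End ProductCells.

(** * Concentration of products *)

Section Sufficiency.
Variable R : realType.
Variables (Fn : nat -> R -> R -> R) (F : R -> R -> R).
Hypotheses (Fn2 : forall n, in_F2 (Fn n)) (F2 : in_F2 F).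
Hypothesis FnF : forall s t : R, 0 <= s -> 0 <= t -> (fun n => Fn n s t) @ \oo --> F s t.

Lemma near_forall_lt (P : nat -> nat -> Prop) (N : nat) :
  (forall i, \forall n \near \oo, P i n) ->
  \forall n \near \oo, forall i, (i < N)%N -> P i n.
Proof.
move=> h; elim: N => [|N IH]; first by apply: nearW.
apply: filterS2 IH (h N) => n h1 h2 i; rewrite ltnS leq_eqVlt => /predU1P[->//|].
exact: h1.
Qed.

Definition upper_inf_cond := forall s t : R, 0 <= s -> 0 <= t ->
  (fun n => Fn n s t - upper_inf (Fn n) s t) @ \oo --> (0 : R).

(** The closeness [e] depends on [X], [Y] and [eta] only, and the threshold for [n] precedes the
    choice of [X'], [Y'] and the maps. The first half is kept apart from the condition on [Fn]
    because the proof of necessity uses it as well. *)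
Lemma prod_close (X Y : mmspace R) (eta : R) : 0 < eta -> exists2 e : R, 0 < e &
  (\forall n \near \oo, forall (X' Y' : mmspace R)
      (phi : R -> bspace X') (psi : R -> bspace X)
      (phi' : R -> bspace Y') (psi' : R -> bspace Y),
    measurable_fun setT phi -> has_law psi -> close e phi psi ->
    measurable_fun setT phi' -> has_law psi' -> close e phi' psi' ->
    forall f, @Lip1 _ (mmprod (Fn n) X' Y') f ->
    exists2 g, @Lip1 _ (mmprod F X Y) g &
    (lam2 (offby eta (fun p => f (phi p.1, phi' p.2))
                     (fun p => g (psi p.1, psi' p.2))) <= eta%:E)%E) /\
  (upper_inf_cond -> \forall n \near \oo, forall (X' Y' : mmspace R)
      (phi : R -> bspace X') (psi : R -> bspace X)
      (phi' : R -> bspace Y') (psi' : R -> bspace Y),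
    measurable_fun setT phi -> has_law psi -> close e phi psi ->
    measurable_fun setT phi' -> has_law psi' -> close e phi' psi' ->
    forall g, @Lip1 _ (mmprod F X Y) g ->
    exists2 f, @Lip1 _ (mmprod (Fn n) X' Y') f &
    (lam2 (offby eta (fun p => f (phi p.1, phi' p.2))
                     (fun p => g (psi p.1, psi' p.2))) <= eta%:E)%E).
Proof.
move=> eta_gt0; have [eta' eta0 ->] : exists2 eta', 0 < eta' & eta = 6 * eta'.
  by exists (eta / 6); [lra|field].
have dX_ge0 (Z : mmspace R) p q : 0 <= mdist Z p q.
  by have [+ _] := mm_metric Z; exact.
have [rho rho0 [FP HB HA]] := mp_equicontinuous Fn2 F2 FnF eta0.
have delta0 : 0 < rho / 8 by lra.
have [x [N covX]] := finite_ball_cover X delta0 eta0.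
have [y [M covY]] := finite_ball_cover Y delta0 eta0.
(* [K] dominates [N], [M] and [4 * N * M], so a single [e] meets all three smallness bounds; the
   successors keep it positive. *)
pose K := (4 * N.+1 * M.+1)%N.
have K0 : 0 < K%:R :> R by rewrite ltr0n !muln_gt0.
pose e := Num.min (rho / 8) (eta' / K%:R).
have e0 : 0 < e by rewrite lt_min delta0 divr_gt0.
have e_rho : e <= rho / 8 by rewrite ge_min lexx.
have e_eta : e * K%:R <= eta' by rewrite -ler_pdivlMr // ge_min lexx orbT.
have Ke (L : nat) : (L <= K)%N -> L%:R * e <= eta'.
  move=> LK; apply: le_trans e_eta; rewrite mulrC ler_wpM2l ?ler_nat // ltW //.
have Ne : N%:R * e <= eta'.
  by apply: Ke; rewrite /K; nia.
have Me : M%:R * e <= eta'.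
  by apply: Ke; rewrite /K; nia.
have NMe : N%:R * (M%:R * (4 * e)) <= eta'.
  rewrite !mulrA -!natrM; apply: Ke; rewrite /K; nia.
have rhoP : 4 * (rho / 8) + 3 * e <= rho by lra.
have delta_rho : 2 * (rho / 8) <= rho by lra.
clearbody e K.
exists e => //; split.
  have near4 := near_forall_lt N (fun i => near_forall_lt N (fun k =>
    near_forall_lt M (fun j => near_forall_lt M (fun l =>
      HB (mdist X (x i) (x k)) (mdist Y (y j) (y l)) (dX_ge0 _ _ _) (dX_ge0 _ _ _))))).
  apply: filterS near4 => n hn X' Y' phi psi phi' psi' mphi hpsi cX mphi' hpsi' cY.
  have [U UP] := cell_system_exists e0 delta0 rhoP Ne mphi hpsi.1 cX (covX _ hpsi).
  have [V VP] := cell_system_exists e0 delta0 rhoP Me mphi' hpsi'.1 cY (covY _ hpsi').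
  apply: (prod_close_down mphi hpsi.1 mphi' hpsi'.1 UP VP (Fn2 n) F2 e0 eta0
    delta_rho NMe FP) => i k j l iN kN jM lM.
  exact: hn.
move=> H2; have near4 := near_forall_lt N (fun i => near_forall_lt N (fun k =>
    near_forall_lt M (fun j => near_forall_lt M (fun l =>
      HA H2 (mdist X (x i) (x k)) (mdist Y (y j) (y l)) (dX_ge0 _ _ _) (dX_ge0 _ _ _))))).
apply: filterS near4 => n hn X' Y' phi psi phi' psi' mphi hpsi cX mphi' hpsi' cY.
have [U UP] := cell_system_exists e0 delta0 rhoP Ne mphi hpsi.1 cX (covX _ hpsi).
have [V VP] := cell_system_exists e0 delta0 rhoP Me mphi' hpsi'.1 cY (covY _ hpsi').
apply: (prod_close_up mphi hpsi.1 mphi' hpsi'.1 UP VP (Fn2 n) F2 e0 eta0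
  delta_rho FP) => i k j l iN kN jM lM.
exact: hn.
Qed.

Lemma lam_square (kappa : R -> R * R) (e : R) (X' X Y' Y : mmspace R)
    (G' G : R -> R -> R) (phi : R -> bspace X') (psi : R -> bspace X)
    (phi' : R -> bspace Y') (psi' : R -> bspace Y) f g :
  square_map kappa -> in_F2 G' -> in_F2 G ->
  has_law phi -> has_law psi -> has_law phi' -> has_law psi' ->
  @Lip1 _ (mmprod G' X' Y') f -> @Lip1 _ (mmprod G X Y) g ->
  lam (offby e (fun t => f (phi (kappa t).1, phi' (kappa t).2))
               (fun t => g (psi (kappa t).1, psi' (kappa t).2))) =
  lam2 (offby e (fun p => f (phi p.1, phi' p.2)) (fun p => g (psi p.1, psi' p.2))).
Proof.
move=> [_ hk] G2' G2 [mphi _] [mpsi _] [mphi' _] [mpsi' _] lf lg.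
rewrite /lam2 -hk //; apply: measurable_offby.
  exact: measurable_lip_prod lf.
exact: measurable_lip_prod lg.
Qed.

Lemma square_map_exists : exists kappa : R -> R * R, square_map kappa.
Proof. by have [kappa h1 h2] := lam_image_square R; exists kappa. Qed.

Lemma prod_concentrates (Xs Ys : nat -> mmspace R) (X Y : mmspace R) :
  upper_inf_cond ->
  concentrates (fun n => mm_data (Xs n)) (mm_data X) ->
  concentrates (fun n => mm_data (Ys n)) (mm_data Y) ->
  concentrates (fun n => mmprod (Fn n) (Xs n) (Ys n)) (mmprod F X Y).
Proof.
move=> H2 cX cY; apply: cvg0_dconc => eta eta0.
have [kappa hk] := square_map_exists.
have [e e0 [down /(_ H2) up]] := prod_close X Y eta0.
have clX := concentrates_close cX e0; have clY := concentrates_close cY e0.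
apply: filterS2 (filterI down up) (filterI clX clY) => n [dn un].
move=> [[phi [psi [hphi hpsi clx]]] [phi' [psi' [hphi' hpsi' cly]]]].
apply: (dconc_close (ltW eta0) (prod_parameter (Fn2 n) hk hphi hphi')
  (prod_parameter F2 hk hpsi hpsi')) => [f lf|g lg].
  have [g lg h] := dn _ _ _ _ _ _ hphi.1 hpsi clx hphi'.1 hpsi' cly f lf.
  by exists g => //; rewrite -(lam_square eta hk (Fn2 n) F2 hphi hpsi hphi' hpsi' lf lg) in h.
have [f lf h] := un _ _ _ _ _ _ hphi.1 hpsi clx hphi'.1 hpsi' cly g lg.
by exists f => //; rewrite -(lam_square eta hk (Fn2 n) F2 hphi hpsi hphi' hpsi' lf lg) in h.
Qed.

End Sufficiency.

(** * Discrete cubes *)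

Section FiniteSpaces.
Variables (R : realType) (T : finType) (x0 : T).

Definition pointed_at (x : T) : Type := T.
HB.instance Definition _ := Finite.on (pointed_at x0).
HB.instance Definition _ := isPointed.Build (pointed_at x0) x0.

Lemma finite_metric_discrete (d : T -> T -> R) : is_metric d ->
  exists2 delta, 0 < delta & forall x y, d x y < delta -> x = y.
Proof.
move=> [d_ge0 [d0 _]].
have : \forall k \near \oo, forall p : T * T, p.1 != p.2 -> k.+1%:R^-1 < d p.1 p.2.
  apply: filter_forall => -[x y] /=.
  have [->|xy] := eqVneq x y; first by apply: nearW.
  have dxy : 0 < d x y.
    rewrite lt_neqAle d_ge0 andbT eq_sym; apply/negP => /eqP/d0 E.
    by rewrite E eqxx in xy.
  by have := near_infty_natSinv_lt (PosNum dxy); apply: filterS => k.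
move=> [k _ /(_ k (leqnn k)) /= hk].
exists k.+1%:R^-1; first by rewrite invr_gt0.
move=> x y dxy; apply/eqP/negP => /negP xy.
by have := lt_trans dxy (hk (x, y) xy); rewrite ltxx.
Qed.

Lemma finite_metric_open (d : T -> T -> R) (A : set T) : is_metric d -> metric_open d A.
Proof.
move=> /finite_metric_discrete[delta delta0 h] x Ax.
by exists delta; split => // y /h <-.
Qed.

Variables (d : T -> T -> R) (dP : is_metric d).

Lemma finite_complete : @metric_complete R (pointed_at x0) d.
Proof.
have [delta delta0 h] := finite_metric_discrete dP.
move=> u /(_ delta delta0)[N hN]; exists (u N) => e e0; exists N => n Nn.
rewrite (h _ _ (hN n N Nn (leqnn N))).
by have [_ [d0 _]] := dP; have /d0 -> := erefl (u N).
Qed.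

Lemma finite_separable : @metric_separable R (pointed_at x0) d.
Proof.
exists (nth x0 (enum T)) => x e e0; exists (index x (enum T)).
rewrite nth_index ?mem_enum //.
by have [_ [d0 _]] := dP; have /d0 -> := erefl x.
Qed.

Definition fin_bspace := g_sigma_algebraType (metric_open (d : pointed_at x0 -> pointed_at x0 -> R)).

Let card_inv_ge0 : 0 <= #|T|%:R^-1 :> R.
Proof. by rewrite invr_ge0. Qed.

Definition uniform_fin : set fin_bspace -> \bar R :=
  mscale (NngNum card_inv_ge0)
    (msum (fun k => \d_(nth x0 (enum T) k : fin_bspace)) #|T|).

HB.instance Definition _ := Measure.on uniform_fin.

Lemma uniform_finE (A : set T) :
  uniform_fin A = (#|T|%:R^-1 * \sum_(x : T) \1_A x)%:E.
Proof.
rewrite /uniform_fin /mscale /msum /= EFinM; congr (_ * _)%E.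
rewrite -sumEFin (eq_bigl (mem T)) // -big_enum /= (big_nth x0) big_mkord /msum cardE.
by apply: eq_bigr.
Qed.

Let uniform_fin_setT : uniform_fin setT = 1%E.
Proof.
rewrite uniform_finE (eq_bigr (fun=> 1)) => [|x _]; last by rewrite indicE in_setT.
rewrite sumr_const mulVf // pnatr_eq0 -lt0n.
by apply/card_gt0P; exists x0.
Qed.

HB.instance Definition _ :=
  Measure_isProbability.Build _ _ _ uniform_fin uniform_fin_setT.

Definition fin_mm : mmspace R :=
  @MMSpace R (pointed_at x0) d dP finite_complete finite_separable uniform_fin.

Lemma measurable_fin_mm (A : set T) : @measurable _ (bspace fin_mm) A.
Proof. by apply: sub_sigma_algebra; exact: finite_metric_open. Qed.

End FiniteSpaces.

Lemma measurable_fin_prod (R : realType) (T1 T2 : finType) (x1 : T1) (x2 : T2)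
    (d1 : T1 -> T1 -> R) (d2 : T2 -> T2 -> R) (d1P : is_metric d1) (d2P : is_metric d2)
    (A : set (T1 * T2)) :
  @measurable _ (bspace (fin_mm x1 d1P) * bspace (fin_mm x2 d2P))%type A.
Proof.
have -> : A = \bigcup_(p in A) ([set p.1] `*` [set p.2]).
  apply/seteqP; split => [p Ap|p [q Aq [/= p1 p2]]]; first by exists p.
  by case: p q p1 p2 Aq => [? ?] [? ?] /= -> ->.
apply: (@countable_bigcup_measurable _ _ (T1 * T2)%type) => p _.
by apply: measurableX; exact: measurable_fin_mm.
Qed.

(** * Concentration on discrete cubes *)

Section Cubes.
Variable R : realType.

Fixpoint cubeT (N : nat) : finType :=
  if N is n.+1 then (bool * cubeT n)%type else unit.

Fixpoint cube0 N : cubeT N :=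
  match N with 0 => tt | n.+1 => (false, cube0 n) end.

Fixpoint ham N : cubeT N -> cubeT N -> nat :=
  match N with
  | 0 => fun _ _ => 0%N
  | n.+1 => fun x y => ((x.1 != y.1) + ham x.2 y.2)%N
  end.

Fixpoint flip N : cubeT N -> cubeT N :=
  match N with
  | 0 => id
  | n.+1 => fun x => (~~ x.1, flip x.2)
  end.

Lemma ham_flip N (x : cubeT N) : ham x (flip x) = N.
Proof. by elim: N x => [//|N IH [b x]] /=; rewrite IH; case: b. Qed.

Lemma ham_eq0 N (x y : cubeT N) : ham x y = 0%N <-> x = y.
Proof.
elim: N x y => [[] []//|N IH [b x] [c y]] /=; split.
  by move=> /eqP; rewrite addn_eq0 eqb0 negbK => /andP[/eqP -> /eqP/IH ->].
by case=> -> ->; rewrite eqxx /=; apply/IH.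
Qed.

Lemma ham_sym N (x y : cubeT N) : ham x y = ham y x.
Proof. by elim: N x y => [//|N IH [b x] [c y]] /=; rewrite IH eq_sym. Qed.

Lemma ham_triangle N (x y z : cubeT N) : (ham x z <= ham x y + ham y z)%N.
Proof.
elim: N x y z => [//|N IH [b x] [c y] [a z]] /=.
rewrite addnACA leq_add //.
by case: b; case: c; case: a.
Qed.

(** Integral against the uniform measure ([meanE]), written coordinate by coordinate so that
    variance can be bounded by induction on the dimension. *)
Fixpoint mean N : (cubeT N -> R) -> R :=
  match N with
  | 0 => fun f => f tt
  | n.+1 => fun f => (mean (fun x => f (true, x)) + mean (fun x => f (false, x))) / 2
  end.

Lemma le_mean N (f g : cubeT N -> R) : (forall x, f x <= g x) -> mean f <= mean g.
Proof.
elim: N f g => [f g fg|N IH f g fg] /=; first exact: fg.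
rewrite ler_pM2r ?invr_gt0 //.
by apply: lerD; exact: IH.
Qed.

Lemma eq_mean N (f g : cubeT N -> R) : f =1 g -> mean f = mean g.
Proof. by move=> /funext ->. Qed.

Lemma mean_cst N (c : R) : mean (fun _ : cubeT N => c) = c.
Proof. by elim: N => //= N ->; field. Qed.

Lemma meanD N (f g : cubeT N -> R) : mean (fun x => f x + g x) = mean f + mean g.
Proof. by elim: N f g => //= N IH f g; rewrite !IH; field. Qed.

Lemma meanZ N (c : R) (f : cubeT N -> R) : mean (fun x => c * f x) = c * mean f.
Proof. by elim: N f => //= N IH f; rewrite !IH; field. Qed.

Lemma sum_bool_prod (T : finType) (f : bool * T -> R) :
  \sum_p f p = \sum_x f (true, x) + \sum_x f (false, x).
Proof.
rewrite (eq_bigr (fun p => f (p.1, p.2))) => [|[]//].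
by rewrite -(pair_bigA _ (fun b x => f (b, x))) /= big_bool.
Qed.

Lemma meanE N (f : cubeT N -> R) : mean f = #|cubeT N|%:R^-1 * \sum_x f x.
Proof.
elim: N f => [|N IH] f /=.
  by rewrite card_unit invr1 mul1r (big_pred1 tt) // => -[].
rewrite !IH -mulrDr card_prod card_bool natrM invfM [_ / 2]mulrC mulrA.
by congr (_ * _); rewrite sum_bool_prod.
Qed.

Lemma mean_sqr_dev N (f : cubeT N -> R) (a : R) :
  mean (fun x => (f x - a) ^+ 2) =
  mean (fun x => (f x - mean f) ^+ 2) + (mean f - a) ^+ 2.
Proof.
rewrite (@eq_mean _ _ (fun x => (f x - mean f) ^+ 2 +
  ((2 * (mean f - a)) * (f x + (- mean f)) + (mean f - a) ^+ 2))); last first.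
  by move=> x; ring.
by rewrite meanD meanD meanZ meanD !mean_cst; ring.
Qed.

Lemma mean_dist N (f g : cubeT N -> R) (c : R) :
  (forall x, `|f x - g x| <= c) -> `|mean f - mean g| <= c.
Proof.
move=> fg; rewrite ler_norml.
have h1 : mean f <= mean (fun x => g x + c).
  by apply: le_mean => x; have := fg x; rewrite ler_norml; lra.
have h2 : mean g <= mean (fun x => f x + c).
  by apply: le_mean => x; have := fg x; rewrite ler_norml; lra.
by move: h1 h2; rewrite !meanD !mean_cst; lra.
Qed.

(** Splitting off one coordinate, the variance is the average of the variances on the two halves
    plus a quarter of the squared difference of their means. Paired points of the halves are at
    Hamming distance 1, so each coordinate adds at most [c ^+ 2 / 4]. *)
Lemma cube_variance N (f : cubeT N -> R) (c : R) :
  (forall x y, `|f x - f y| <= c * (ham x y)%:R) ->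
  mean (fun x => (f x - mean f) ^+ 2) <= N%:R * c ^+ 2 / 4.
Proof.
elim: N f => [|N IH] f lf /=; first by rewrite subrr expr0n /= !mul0r.
set m1 := mean (fun x => f (true, x)); set m0 := mean (fun x => f (false, x)).
have l1 := IH (fun x => f (true, x)) (fun x y => lf (true, x) (true, y)).
have l0 := IH (fun x => f (false, x)) (fun x y => lf (false, x) (false, y)).
rewrite (mean_sqr_dev (fun x => f (true, x)) ((m1 + m0) / 2)).
rewrite (mean_sqr_dev (fun x => f (false, x)) ((m1 + m0) / 2)) -/m1 -/m0.
rewrite -/m1 in l1; rewrite -/m0 in l0.
have : `|m1 - m0| <= c.
  apply: mean_dist => x; have := lf (true, x) (false, x).
  by rewrite /= (_ : ham x x = 0%N) ?mulr1 //; apply/ham_eq0.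
rewrite ler_norml => /andP[hm1 hm2].
have hm : (m1 - m0) ^+ 2 <= c ^+ 2.
  by rewrite -subr_ge0 subr_sqr; apply: mulr_ge0; lra.
have -> : N.+1%:R * c ^+ 2 / 4 = N%:R * c ^+ 2 / 4 + c ^+ 2 / 4.
  by rewrite -(natr1 N); field.
have -> : (m1 - (m1 + m0) / 2) ^+ 2 = (m1 - m0) ^+ 2 / 4 by field.
have -> : (m0 - (m1 + m0) / 2) ^+ 2 = (m1 - m0) ^+ 2 / 4 by field.
have h2 : 0 < 2 :> R by [].
rewrite ler_pdivrMr //.
move: l1 l0 hm; set A1 := mean _; set A0 := mean _; set B := N%:R * _ / _.
by move: A1 A0 B (c ^+ 2) ((m1 - m0) ^+ 2) => A1 A0 B C D *; lra.
Qed.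

Lemma cube_chebyshev N (f : cubeT N -> R) (c eta : R) : 0 < eta ->
  (forall x y, `|f x - f y| <= c * (ham x y)%:R) ->
  mean \1_(offby eta f (fun=> mean f)) <= N%:R * c ^+ 2 / 4 / eta ^+ 2.
Proof.
move=> eta0 lf; have eta20 : 0 < eta ^+ 2 by exact: exprn_gt0.
rewrite ler_pdivlMr // mulrC -meanZ.
apply: le_trans (cube_variance lf); apply: le_mean => x.
rewrite indicE; case: (boolP (x \in _)) => [/set_mem hx|_]; last first.
  by rewrite mulr0 sqr_ge0.
rewrite mulr1 -(real_normK (num_real (f x - mean f))).
by apply: lerXn2r; rewrite ?nnegrE //; exact: ltW.
Qed.

Lemma is_metric_bool (s : R) : 0 < s ->
  is_metric (fun b c : bool => s * (b != c)%:R).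
Proof.
move=> s0; split=> [b c|]; first by rewrite mulr_ge0 // ltW.
split=> [b c|].
  by split=> [|->]; [case: b; case: c => //=; rewrite mulr1; lra|rewrite eqxx mulr0].
by split=> [b c|a b c]; [rewrite eq_sym|case: a; case: b; case: c => /=; lra].
Qed.

Definition two_points (s : R) (s0 : 0 < s) : mmspace R :=
  fin_mm true (is_metric_bool s0).

(** The first coordinate names the cluster; the remaining [N] run over a cube of edge [c]. *)
Definition cube_dist (s c : R) N (x y : cubeT N.+1) : R :=
  s * (x.1 != y.1)%:R + c * (ham x.2 y.2)%:R.

Lemma is_metric_cube (s c : R) N : 0 < s -> 0 < c -> is_metric (@cube_dist s c N).
Proof.
move=> s0 c0; have [b_ge0 [b0 [bC bT]]] := is_metric_bool s0.
have h_ge0 (x y : cubeT N) : 0 <= c * (ham x y)%:R by rewrite mulr_ge0 // ltW.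
split=> [x y|]; first exact: addr_ge0.
split=> [x y|].
  split=> [/eqP|->]; last first.
    rewrite /cube_dist eqxx (_ : ham y.2 y.2 = 0%N) ?mulr0 ?addr0 //.
    exact/ham_eq0.
  rewrite paddr_eq0 // => /andP[/eqP/b0 E1]; rewrite mulf_eq0 gt_eqF //=.
  rewrite pnatr_eq0 => /eqP/ham_eq0 E2.
  by case: x y E1 E2 => [x1 x2] [y1 y2] /= -> ->.
split=> [x y|x y z]; first by rewrite /cube_dist bC ham_sym.
rewrite /cube_dist addrACA lerD //.
by rewrite -mulrDr ler_pM2l // -natrD ler_nat ham_triangle.
Qed.

Definition cube_space (s c : R) (s0 : 0 < s) (c0 : 0 < c) N : mmspace R :=
  fin_mm (cube0 N.+1) (is_metric_cube N s0 c0).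

Lemma cube_spaceP (s c : R) (s0 : 0 < s) (c0 : 0 < c) N (A : set (cubeT N.+1)) :
  mm_P (cube_space s0 c0 N) A = (mean \1_A)%:E.
Proof. by rewrite meanE; exact: uniform_finE. Qed.

Lemma cube_flip_dist (s c : R) N (x : cubeT N.+1) :
  cube_dist s c x (flip x) = s + c * N%:R.
Proof.
rewrite /cube_dist /= ham_flip; congr (_ + _).
by case: x.1 => /=; rewrite mulr1.
Qed.

Lemma mean_flip N (f : cubeT N -> R) : mean (f \o @flip N) = mean f.
Proof.
elim: N f => [//|N IH] f /=.
rewrite -(IH (fun x => f (true, x))) -(IH (fun x => f (false, x))).
by rewrite addrC.
Qed.

Lemma cube_flip_law (s c : R) (s0 : 0 < s) (c0 : 0 < c) N (A : set (cubeT N.+1)) :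
  mm_P (cube_space s0 c0 N) (@flip N.+1 @^-1` A) = mm_P (cube_space s0 c0 N) A.
Proof.
by rewrite !cube_spaceP -[in RHS]mean_flip.
Qed.

Lemma cube_fst_law (s c : R) (s0 : 0 < s) (c0 : 0 < c) N (B : set bool) :
  mm_P (cube_space s0 c0 N) ((fun x : cubeT N.+1 => x.1) @^-1` B) =
  mm_P (two_points s0) B.
Proof.
rewrite cube_spaceP.
have -> : mm_P (two_points s0) B = (2^-1 * (\1_B true + \1_B false))%:E.
  by rewrite [LHS]uniform_finE card_bool big_bool.
congr (_%:E).
have E b : mean (fun u : cubeT N =>
    \1_((fun x : cubeT N.+1 => x.1) @^-1` B) (b, u)) = \1_B b :> R.
  by rewrite -[RHS](mean_cst N); apply: eq_mean => u; rewrite !indicE.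
by rewrite /= !E mulrC.
Qed.

(* The mean of a 1-Lipschitz function over each of the two cubes is a
   1-Lipschitz function on the two-point space. *)
Lemma cube_close (s c : R) (s0 : 0 < s) (c0 : 0 < c) N (e : R)
    (phi : R -> bspace (cube_space s0 c0 N)) :
  0 < e -> N%:R * c ^+ 2 / 4 / e ^+ 2 <= e -> has_law phi ->
  has_law ((fun t => (phi t).1) : R -> bspace (two_points s0)) /\
  close e phi ((fun t => (phi t).1) : R -> bspace (two_points s0)).
Proof.
move=> e0 Ne [mphi hphi]; split.
  split.
    move=> _ B _; rewrite setTI.
    have := mphi measurableT ((fun x : cubeT N.+1 => x.1) @^-1` B).
    by rewrite setTI; apply; exact: measurable_fin_mm.
  move=> B _; rewrite -(cube_fst_law s0 c0 N B) -hphi //.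
  exact: measurable_fin_mm.
have lam_phi (A : set (cubeT N.+1)) : lam (phi @^-1` A) = (mean \1_A)%:E.
  by rewrite -(cube_spaceP s0 c0); apply: hphi; exact: measurable_fin_mm.
split=> [f lf|g lg]; last first.
  exists (fun x : cubeT N.+1 => g x.1).
    move=> x y /=; apply: (le_trans (lg x.1 y.1)).
    by rewrite /= /cube_dist lerDl mulr_ge0 // ltW.
  rewrite (_ : offby _ _ _ = set0) ?measure0 ?lee_fin ?ltW //.
  by apply/seteqP; split => // t; rewrite /offby /= subrr normr0 ltNge (ltW e0).
pose fb (b : bool) (u : cubeT N) : R := f (b, u).
have lfb b u v : `|fb b u - fb b v| <= c * (ham u v)%:R.
  apply: (le_trans (lf (b, u) (b, v))).
  by rewrite /= /cube_dist /= eqxx mulr0 add0r.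
exists (fun b : bool => mean (fb b)).
  move=> b b' /=; apply: mean_dist => u.
  apply: (le_trans (lf (b, u) (b', u))).
  rewrite /= /cube_dist /= (_ : ham u u = 0%N) ?mulr0 ?addr0 //.
  exact/ham_eq0.
have -> : offby e (f \o phi) ((fun b : bool => mean (fb b)) \o (fun t => (phi t).1)) =
  phi @^-1` (offby e f (fun x : cubeT N.+1 => mean (fb x.1))) by [].
rewrite lam_phi lee_fin /=.
have key b : mean (fun u : cubeT N =>
    \1_(offby e f (fun x : cubeT N.+1 => mean (fb x.1))) (b, u)) <= e.
  apply: le_trans Ne; apply: le_trans (cube_chebyshev e0 (lfb b)).
  by apply: le_mean => u; rewrite !indicE.
by have := key true; have := key false; move: (mean _) (mean _) => *; lra.
Qed.

End Cubes.

(** * Necessity of the condition *)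

Section UniformCoupling.
Variables (R : realType) (Q : finType) (dF D : Q -> Q -> R) (Psi chi : R -> Q)
  (theta M : R).
Hypotheses (mPsi : forall p, measurable (@I01 R `&` Psi @^-1` [set p]))
  (mchi : forall q, measurable (@I01 R `&` chi @^-1` [set q])).
Hypotheses (lawPsi : forall p, lam (Psi @^-1` [set p]) = (#|Q|%:R^-1)%:E)
  (lawchi : forall q, lam (chi @^-1` [set q]) = (#|Q|%:R^-1)%:E).
Hypotheses (Q0 : (0 < #|Q|)%N) (theta0 : 0 <= theta)
  (dFM : forall p q, dF p q <= M) (dFxx : forall p, dF p p = 0)
  (D0 : forall p q, 0 <= D p q).
Hypothesis close_g : forall p, exists2 g : Q -> R,
  (forall q q', `|g q - g q'| <= D q q') &
  (lam (offby theta (dF p \o Psi) (g \o chi)) <= theta%:E)%E.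

Let E p q := (@I01 R `&` Psi @^-1` [set p]) `&` (@I01 R `&` chi @^-1` [set q]).
(** Joint law of [Psi] and [chi]: a coupling of the uniform law on [Q] with itself about which
    nothing more is known. *)
Let w p q : R := fine (lam (E p q)).

Let mE p q : measurable (E p q). Proof. exact: measurableI. Qed.

Let wE p q : lam (E p q) = (w p q)%:E.
Proof. by rewrite fineK // fin_num_measure. Qed.

Let w_ge0 p q : 0 <= w p q. Proof. by rewrite -lee_fin -wE. Qed.

Let w_le1 p q : w p q <= 1.
Proof. by rewrite -lee_fin -wE; exact: lam_le1. Qed.

Let sum_cells (T : finType) (A : T -> set R) : (forall i, measurable (A i)) ->
  (forall i j t, A i t -> A j t -> i = j) ->
  lam (\bigcup_i A i) = (\sum_i lam (A i))%E.
Proof.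
move=> mA tA; rewrite (@measure_fin_bigcup _ _ _ (@lam R)) //.
- have -> : [set: T] = [set` index_enum T].
    by apply/seteqP; split => i //= _; exact: mem_index_enum.
  by rewrite -fsbig_seq ?index_enum_uniq.
- exact: finite_finset.
- by move=> i j _ _ [t [Ai Aj]]; exact: tA Ai Aj.
Qed.

Let marginal1 p : \sum_q w p q = #|Q|%:R^-1.
Proof.
apply: EFin_inj; rewrite -(lawPsi p) -sumEFin.
rewrite (eq_bigr (fun q => lam (E p q))) => [|q _]; last by rewrite wE.
rewrite -sum_cells //; last by move=> q q' t [_ [_ /= <-]] [_ [_ /= <-]].
apply: eq_lam => t It; split=> [[q _ [[]]]//|pt].
by exists (chi t).
Qed.

Let marginal2 q : \sum_p w p q = #|Q|%:R^-1.
Proof.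
apply: EFin_inj; rewrite -(lawchi q) -sumEFin.
rewrite (eq_bigr (fun p => lam (E p q))) => [|p _]; last by rewrite wE.
rewrite -sum_cells //; last by move=> p p' t [[_ /= <-] _] [[_ /= <-] _].
apply: eq_lam => t It; split=> [[p _ [_ []]]//|qt].
by exists (Psi t).
Qed.

Let sum_prod (u v : Q -> R) :
  \sum_(P : Q * Q) u P.1 * v P.2 = (\sum_p u p) * (\sum_p v p).
Proof. by rewrite -(pair_bigA _ (fun a b => u a * v b)) /= big_distrlr. Qed.

(* Integrating [dF (Psi u) (Psi u')] and [D (chi u) (chi u')] over independent
   [u], [u'] removes the unknown relation between the two parameters. *)
Lemma uniform_coupling :
  \sum_(P : Q * Q) dF P.1 P.2 <= \sum_(S : Q * Q) D S.1 S.2 +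
    #|Q|%:R ^+ 2 * (2 * theta + (#|Q|%:R ^+ 4) * (#|Q|%:R * theta * M)).
Proof.
pose k : R := #|Q|%:R; rewrite -/k.
have k0 : 0 < k by rewrite ltr0n.
have hg p : exists gp : Q -> R, (forall q q', `|gp q - gp q'| <= D q q') /\
    (lam (offby theta (dF p \o Psi) (gp \o chi)) <= theta%:E)%E.
  by have [gp h1 h2] := close_g p; exists gp.
have [g gP] := choice hg.
pose bad := \bigcup_(p in [set` enum Q]) offby theta (dF p \o Psi) (g p \o chi).
have badE p t : offby theta (dF p \o Psi) (g p \o chi) t -> bad t.
  by exists p; rewrite //= mem_enum.
have bad_le : (lam bad <= (k * theta)%:E)%E.
  rewrite /bad /k cardE; elim: (enum Q) => [|p r IH].
    by rewrite set_nil bigcup_set0 measure0 mul0r.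
  apply: (@le_trans _ _ (lam (offby theta (dF p \o Psi) (g p \o chi) `|`
      \bigcup_(p in [set` r]) offby theta (dF p \o Psi) (g p \o chi)))).
    apply: le_lam => t [q /=]; rewrite in_cons => /predU1P[->|qr] ht; first by left.
    by right; exists q.
  apply: (le_trans (lamU2 _ _)).
  rewrite -(natr1 (size r)) mulrDl mul1r addrC EFinD; apply: leeD => //.
  by have [] := gP p.
have M0 : 0 <= M.
  by have /card_gt0P[p _] := Q0; rewrite -(dFxx p).
have kt0 : 0 <= k * theta by rewrite mulr_ge0 // ltW.
have avoid p q : k * theta < w p q -> exists2 t, E p q t & ~ bad t.
  move=> hw; apply: contrapT => h.
  have /le_lam : E p q `<=` bad.
    by move=> t Et; apply: contrapT => nb; apply: h; exists t.
  by rewrite wE => /le_trans/(_ bad_le); rewrite lee_fin leNgt hw.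
(* If both weights exceed the mass of [bad], both cells contain good points, and the function
   [g P.1] gives [dF P.1 P.2 <= D S.1 S.2 + 2 * theta]. Otherwise the product of the weights is at
   most [k * theta]. *)
have key (P S : Q * Q) : w P.1 S.1 * w P.2 S.2 * (dF P.1 P.2 - D S.1 S.2 - 2 * theta)
    <= k * theta * M.
  have ktM0 : 0 <= k * theta * M by exact: mulr_ge0.
  have [X0|X0] := leP (dF P.1 P.2 - D S.1 S.2 - 2 * theta) 0.
    by apply: le_trans ktM0; rewrite mulr_ge0_le0 // mulr_ge0.
  have XM : dF P.1 P.2 - D S.1 S.2 - 2 * theta <= M.
    have := dFM P.1 P.2; have := D0 S.1 S.2; have := theta0.
    by move: (dF _ _) (D _ _) => *; lra.
  have [w1|w1] := leP (w P.1 S.1) (k * theta).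
    apply: ler_pM => //; [exact: mulr_ge0|exact: ltW|].
    by rewrite -[leRHS]mulr1; apply: ler_pM.
  have [w2|w2] := leP (w P.2 S.2) (k * theta).
    apply: ler_pM => //; [exact: mulr_ge0|exact: ltW|].
    by rewrite mulrC -[leRHS]mulr1; apply: ler_pM.
  have [t [[_ /= Pt] [_ /= ct]] nt] := avoid _ _ w1.
  have [t' [[_ /= Pt'] [_ /= ct']] nt'] := avoid _ _ w2.
  have h1 : `|dF P.1 (Psi t) - g P.1 (chi t)| <= theta.
    by rewrite leNgt; apply/negP => h; apply/nt/(badE P.1).
  have h2 : `|dF P.1 (Psi t') - g P.1 (chi t')| <= theta.
    by rewrite leNgt; apply/negP => h; apply/nt'/(badE P.1).
  have h3 := (gP P.1).1 S.1 S.2.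
  move: h1 h2 h3 X0; rewrite Pt Pt' ct ct' dFxx !ler_norml.
  move: (dF _ _) (D _ _) (g _ _) (g _ _) => a b c d *; exfalso.
  by move: theta0 => *; lra.
have sumkey : \sum_(P : Q * Q) \sum_(S : Q * Q)
    w P.1 S.1 * w P.2 S.2 * (dF P.1 P.2 - D S.1 S.2 - 2 * theta)
    <= k ^+ 4 * (k * theta * M).
  apply: (@le_trans _ _ (\sum_(P : Q * Q) \sum_(S : Q * Q) k * theta * M)).
    by apply: ler_sum => P _; apply: ler_sum => S _; exact: key.
  rewrite sumr_const sumr_const card_prod -!mulrnA -[leLHS]mulr_natl.
  by rewrite !natrM -/k (_ : k * k * (k * k) = k ^+ 4) //; ring.
(* Uniform marginals give every pair the same total weight, so the sums of [dF] and of [D] come out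
   with the same factor. The power [k ^+ 4] above counts the choices of (P, S). *)
have W1 P : \sum_(S : Q * Q) w P.1 S.1 * w P.2 S.2 = k ^- 2.
  by rewrite (sum_prod (w P.1) (w P.2)) !marginal1 -exprVn expr2.
have W2 S : \sum_(P : Q * Q) w P.1 S.1 * w P.2 S.2 = k ^- 2.
  by rewrite (sum_prod (w^~ S.1) (w^~ S.2)) !marginal2 -exprVn expr2.
have EA : \sum_(P : Q * Q) \sum_(S : Q * Q) w P.1 S.1 * w P.2 S.2 * dF P.1 P.2 =
    k ^- 2 * \sum_(P : Q * Q) dF P.1 P.2.
  rewrite mulr_sumr; apply: eq_bigr => P _.
  by rewrite -mulr_suml W1.
have EB : \sum_(P : Q * Q) \sum_(S : Q * Q) w P.1 S.1 * w P.2 S.2 * D S.1 S.2 =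
    k ^- 2 * \sum_(S : Q * Q) D S.1 S.2.
  rewrite exchange_big /= mulr_sumr; apply: eq_bigr => S _.
  by rewrite -mulr_suml W2.
have EC : \sum_(P : Q * Q) \sum_(S : Q * Q) w P.1 S.1 * w P.2 S.2 * (2 * theta) =
    2 * theta.
  rewrite (eq_bigr (fun=> k ^- 2 * (2 * theta))) => [|P _]; last first.
    by rewrite -mulr_suml W1.
  rewrite sumr_const card_prod -[LHS]mulr_natl natrM -/k; field.
  by rewrite gt_eqF.
have : k ^- 2 * \sum_(P : Q * Q) dF P.1 P.2 - k ^- 2 * \sum_(S : Q * Q) D S.1 S.2
    - 2 * theta <= k ^+ 4 * (k * theta * M).
  rewrite -EA -EB -[X in _ - X <= _]EC -!sumrB; apply: le_trans sumkey.
  by apply: ler_sum => P _; rewrite -!sumrB; apply: ler_sum => S _; rewrite !mulrBr.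
rewrite -mulrBr lerBlDl -ler_pdivlMl ?invr_gt0 ?exprn_gt0 // invrK.
by rewrite lerBlDl.
Qed.

End UniformCoupling.

Section Necessity.
Variable R : realType.

Lemma close_le (X' X : mmspace R) (phi : R -> bspace X') (psi : R -> bspace X)
  (e e' : R) : e <= e' -> close e phi psi -> close e' phi psi.
Proof.
move=> ee' [h1 h2].
have mono (f g : R -> R) : (lam (offby e f g) <= e%:E)%E -> (lam (offby e' f g) <= e'%:E)%E.
  move=> h; apply: (@le_trans _ _ (lam (offby e f g))).
    by apply: le_lam => t; exact: le_lt_trans.
  by apply: (le_trans h); rewrite lee_fin.
split=> [f /h1[g lg h]|g /h2[f lf h]]; first by exists g => //; exact: mono.
by exists f => //; exact: mono.
Qed.

(** With edge [L / N] the diameter stays [L], while the Chebyshev bound becomes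
    [L ^+ 2 / (4 * N * e ^+ 2)]; any [N] above [L ^+ 2 / e ^+ 3] suffices. *)
Lemma cube_side (L e : R) : 0 < L -> 0 < e -> exists Nc : nat * R,
  [/\ 0 < Nc.2, Nc.2 * Nc.1%:R = L & Nc.1%:R * Nc.2 ^+ 2 / 4 / e ^+ 2 <= e].
Proof.
move=> L0 e0; pose N := (Num.truncn (L ^+ 2 / e ^+ 3)).+1.
have N0 : 0 < N%:R :> R by rewrite ltr0n.
have hN : L ^+ 2 / e ^+ 3 <= N%:R by apply/ltW; exact: truncnS_gt.
clearbody N; exists (N, L / N%:R); split => /=.
- exact: divr_gt0.
- by rewrite mulfVK // gt_eqF.
have -> : N%:R * (L / N%:R) ^+ 2 / 4 / e ^+ 2 = (L ^+ 2 / e ^+ 3) / N%:R * e / 4.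
  by field; rewrite !gt_eqF.
have h1 : L ^+ 2 / e ^+ 3 / N%:R <= 1 by rewrite ler_pdivrMr // mul1r.
have h2 : L ^+ 2 / e ^+ 3 / N%:R * e <= e by rewrite -[leRHS]mul1r ler_pM2r.
move: h2; move: (L ^+ 2 / e ^+ 3 / N%:R * e) => z; lra.
Qed.

Section OneProduct.
Variables (s t c c' : R) (s0 : 0 < s) (t0 : 0 < t) (c0 : 0 < c) (c0' : 0 < c')
  (N N' : nat).
Let Xn := cube_space s0 c0 N.
Let Yn := cube_space t0 c0' N'.
Let X := two_points s0.
Let Y := two_points t0.
Let P := (mm_P Xn \x mm_P Yn)%E.
Let pr (z : cubeT N.+1 * cubeT N'.+1) : bool * bool := (z.1.1, z.2.1).

Lemma two_points_prod (F : R -> R -> R) (q : bool * bool) :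
  @md_mu _ (mmprod F X Y) [set q] = (4^-1)%:E.
Proof.
have half (u : R) (u0 : 0 < u) (b : bool) : mm_P (two_points u0) [set b] = (2^-1)%:E.
  have E (a : bool) : \1_[set b] a = (a == b)%:R :> R.
    rewrite indicE; have -> // : (a \in [set b]) = (a == b).
    by apply/idP/eqP => [/set_mem|->] //; rewrite inE.
  rewrite [LHS]uniform_finE card_bool big_bool !E.
  by case: b {E} => /=; rewrite ?addr0 ?add0r mulr1.
have -> : [set q] = [set q.1] `*` [set q.2].
  by apply/seteqP; split => [_ ->//|[a b] [/= -> ->]]; case: q.
transitivity (mm_P X [set q.1] * mm_P Y [set q.2])%E.
  by apply: product_measure1E; exact: measurable_fin_mm.
by rewrite !half -EFinM; congr (_%:E); field.
Qed.

Lemma cubes_prod (q : bool * bool) : P (pr @^-1` [set q]) = (4^-1)%:E.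
Proof.
rewrite -(two_points_prod (fun _ _ => 0) q).
have -> : pr @^-1` [set q] = (fun z : cubeT N.+1 * cubeT N'.+1 =>
  ((fun x : cubeT N.+1 => x.1) z.1, (fun y : cubeT N'.+1 => y.1) z.2)) @^-1` [set q] by [].
apply: (@product_image R _ _ _ _ (bspace Xn) (bspace Yn) (bspace X) (bspace Y)
  (mm_P Xn) (mm_P Yn) (mm_P X) (mm_P Y)).
- by move=> _ B _; exact: measurable_fin_mm.
- by move=> _ B _; exact: measurable_fin_mm.
- by move=> B _; exact: cube_fst_law.
- by move=> B _; exact: cube_fst_law.
- exact: measurable_fin_prod.
Qed.

(* The antipodal map preserves the measure, exchanges opposite clusters and
   moves every point by the same distance, in both factors. *)
Lemma antipodal_bound (G : R -> R -> R) (f : cubeT N.+1 * cubeT N'.+1 -> R)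
    (g : bool * bool -> R) (theta : R) : in_F2 G ->
  @Lip1 _ (mmprod G Xn Yn) f -> 2 * theta < 4^-1 ->
  (P (offby theta f (g \o pr)) <= theta%:E)%E ->
  forall q, `|g q - g (~~ q.1, ~~ q.2)| <= G (s + c * N%:R) (t + c' * N'%:R) + 2 * theta.
Proof.
move=> G2 lf th4 hS q.
pose S : set (bspace Xn * bspace Yn) := offby theta f (g \o pr).
pose A (z : bspace Xn * bspace Yn) : bspace Xn * bspace Yn := (flip z.1, flip z.2).
have mS : measurable S by exact: measurable_fin_prod.
have PA : (P (A @^-1` S) <= theta%:E)%E.
  apply: le_trans hS; rewrite le_eqVlt; apply/orP; left; apply/eqP.
  apply: (@product_image R _ _ _ _ (bspace Xn) (bspace Yn) (bspace Xn) (bspace Yn)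
    (mm_P Xn) (mm_P Yn) (mm_P Xn) (mm_P Yn)) => //.
  - by move=> _ B _; exact: measurable_fin_mm.
  - by move=> _ B _; exact: measurable_fin_mm.
  - by move=> B _; exact: cube_flip_law.
  - by move=> B _; exact: cube_flip_law.
(* The preimage of [q] has mass 1 / 4, more than the [2 * theta] that the exceptional set and its
   antipodal image can cover. *)
have [z zq [nS nA]] : exists2 z, pr z = q & ~ S z /\ ~ (A @^-1` S) z.
  apply: contrapT => h.
  have sub : pr @^-1` [set q] `<=` S `|` A @^-1` S.
    move=> z zq; apply: contrapT => /not_orP nz; apply: h.
    by exists z.
  have mU : @measurable _ (bspace Xn * bspace Yn)%type (S `|` A @^-1` S).
    exact: measurable_fin_prod.
  have mq : @measurable _ (bspace Xn * bspace Yn)%type (pr @^-1` [set q]).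
    exact: measurable_fin_prod.
  have : (P (pr @^-1` [set q]) <= P (S `|` A @^-1` S))%E.
    by apply: le_measure; rewrite ?inE.
  rewrite cubes_prod leNgt => /negP; apply.
  apply: (@le_lt_trans _ _ (P S + P (A @^-1` S))%E).
    by apply: measureU2 => //; exact: measurable_fin_prod.
  apply: (@le_lt_trans _ _ (theta%:E + theta%:E)%E); first exact: leeD.
  by rewrite -EFinD lte_fin; lra.
have h1 : `|f z - g q| <= theta by rewrite -zq leNgt; apply/negP.
have h2 : `|f (A z) - g (~~ q.1, ~~ q.2)| <= theta.
  by rewrite -zq leNgt; apply/negP.
have h3 := lf z (A z).
have E3 : @md_d _ (mmprod G Xn Yn) z (A z) = G (s + c * N%:R) (t + c' * N'%:R).
  rewrite /= -(cube_flip_dist s c z.1) -(cube_flip_dist t c' z.2) //.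
rewrite E3 in h3; move: h1 h2 h3; rewrite !ler_norml.
move: (f z) (f (A z)) (g q) (g _) (G _ _) => *; lra.
Qed.

End OneProduct.

Variables (Fn : nat -> R -> R -> R) (F : R -> R -> R).
Hypotheses (Fn2 : forall n, in_F2 (Fn n)) (F2 : in_F2 F).
Hypothesis FnF : forall s t : R, 0 <= s -> 0 <= t -> (fun n => Fn n s t) @ \oo --> F s t.
Hypothesis H1 : forall (Xs Ys : nat -> mmspace R) (X Y : mmspace R),
  concentrates (fun n => mm_data (Xs n)) (mm_data X) ->
  concentrates (fun n => mm_data (Ys n)) (mm_data Y) ->
  concentrates (fun n => mmprod (Fn n) (Xs n) (Ys n)) (mmprod F X Y).

Lemma cubes_concentrate (s : R) (s0 : 0 < s) (Nc : nat -> nat * R)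
    (c0 : forall n, 0 < (Nc n).2) :
  (forall n, (Nc n).1%:R * (Nc n).2 ^+ 2 / 4 / n.+1%:R^-1 ^+ 2 <= n.+1%:R^-1) ->
  forall e : R, 0 < e -> \forall n \near \oo,
    forall phi : R -> bspace (cube_space s0 (c0 n) (Nc n).1), has_law phi ->
    has_law ((fun t => (phi t).1) : R -> bspace (two_points s0)) /\
    close e phi ((fun t => (phi t).1) : R -> bspace (two_points s0)).
Proof.
move=> hN e e0; apply: filterS (near_infty_natSinv_lt (PosNum e0)) => n /= ne phi hphi.
have n0 : 0 < n.+1%:R^-1 :> R by rewrite invr_gt0.
have [h1 h2] := cube_close n0 (hN n) hphi.
by split => //; exact: close_le (ltW ne) h2.
Qed.

Lemma cubes_concentrate_dconc (s : R) (s0 : 0 < s) (Nc : nat -> nat * R)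
    (c0 : forall n, 0 < (Nc n).2) :
  (forall n, (Nc n).1%:R * (Nc n).2 ^+ 2 / 4 / n.+1%:R^-1 ^+ 2 <= n.+1%:R^-1) ->
  concentrates (fun n => mm_data (cube_space s0 (c0 n) (Nc n).1))
    (mm_data (two_points s0)).
Proof.
move=> hN; apply: cvg0_dconc => e e0.
apply: filterS (cubes_concentrate s0 c0 hN e0) => n h.
have [phi hphi] := has_law_exists (cube_space s0 (c0 n) (Nc n).1).
have [hpsi [h1 h2]] := h phi hphi.
exact: (dconc_close (ltW e0) (parameter_has_law hphi) (parameter_has_law hpsi) h1 h2).
Qed.

Local Notation Q := (bool * bool)%type.

Lemma upper_inf_strict (s t e0 : R) : 0 < s -> 0 < t -> 0 < e0 ->
  \forall n \near \oo, forall s' t', s < s' -> t < t' -> Fn n s t - e0 < Fn n s' t'.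
Proof.
move=> s0 t0 e00; apply: contrapT => hnot.
(* Every eventual property holds at some bad [n], so one index is enough and no subsequence is
   extracted. *)
have freq (A : nat -> Prop) : (\forall n \near \oo, A n) -> exists n, A n /\
    ~ (forall s' t', s < s' -> t < t' -> Fn n s t - e0 < Fn n s' t').
  move=> hA; apply: contrapT => h; apply: hnot; apply: filterS hA => n An.
  by apply: contrapT => hn; apply: h; exists n.
(* At good indices (s + 1, t + 1) is a filler: the sequences of cubes must be defined for every [n]
   before [H1] applies. *)
have pick n : exists st : R * R, [/\ s < st.1, t < st.2 &
    ~ (forall s' t', s < s' -> t < t' -> Fn n s t - e0 < Fn n s' t') ->
    Fn n st.1 st.2 <= Fn n s t - e0].
  have [good|] := pselect (forall s' t', s < s' -> t < t' -> Fn n s t - e0 < Fn n s' t').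
    by exists (s + 1, t + 1); split => //=; lra.
  move=> bad; have [s' /existsNP[t' /not_implyP[ss' /not_implyP[tt' /negP]]]] :=
    (existsNP _).2 bad.
  by rewrite -leNgt => h; exists (s', t').
have [st stP] := choice pick.
have n0 n : 0 < n.+1%:R^-1 :> R by rewrite invr_gt0.
have sideX n : exists Nc : nat * R, [/\ 0 < Nc.2, Nc.2 * Nc.1%:R = (st n).1 - s &
    Nc.1%:R * Nc.2 ^+ 2 / 4 / n.+1%:R^-1 ^+ 2 <= n.+1%:R^-1].
  by apply: cube_side => //; case: (stP n) => h _ _; rewrite subr_gt0.
have sideY n : exists Nc : nat * R, [/\ 0 < Nc.2, Nc.2 * Nc.1%:R = (st n).2 - t &
    Nc.1%:R * Nc.2 ^+ 2 / 4 / n.+1%:R^-1 ^+ 2 <= n.+1%:R^-1].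
  by apply: cube_side => //; case: (stP n) => _ h _; rewrite subr_gt0.
have [NX NXP] := choice sideX; have [NY NYP] := choice sideY.
have cX n : 0 < (NX n).2 by case: (NXP n).
have cY n : 0 < (NY n).2 by case: (NYP n).
have hX n : (NX n).1%:R * (NX n).2 ^+ 2 / 4 / n.+1%:R^-1 ^+ 2 <= n.+1%:R^-1.
  by case: (NXP n).
have hY n : (NY n).1%:R * (NY n).2 ^+ 2 / 4 / n.+1%:R^-1 ^+ 2 <= n.+1%:R^-1.
  by case: (NYP n).
have sX n : s + (NX n).2 * (NX n).1%:R = (st n).1.
  by case: (NXP n) => _ -> _; rewrite addrCA subrr addr0.
have tY n : t + (NY n).2 * (NY n).1%:R = (st n).2.
  by case: (NYP n) => _ -> _; rewrite addrCA subrr addr0.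
pose Xs n := cube_space s0 (cX n) (NX n).1.
pose Ys n := cube_space t0 (cY n) (NY n).1.
pose X := two_points s0; pose Y := two_points t0.
have concXY := H1 (cubes_concentrate_dconc s0 cX hX) (cubes_concentrate_dconc t0 cY hY).
pose dF : Q -> Q -> R := @md_d _ (mmprod F X Y).
have mdF : is_metric dF := is_metric_mmprod X Y F2.
have [dF_ge0 [dF0 [dFC dFT]]] := mdF.
pose M := \sum_(S : Q * Q) dF S.1 S.2.
have dFM p q : dF p q <= M.
  by rewrite /M (bigD1 (p, q)) //= lerDl sumr_ge0.
have M0 : 0 <= M by apply: le_trans (dFM (true, true) (true, true)).
(* The error in [uniform_coupling] for four points and tolerance [2 * theta] is [2 * (theta * C)].
   The last bound on [theta] makes it at most e0 / 4, less than the gain e0 / 2 on opposite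
   pairs. *)
pose C : R := 16 * (2 + 256 * (4 * M)).
have C0 : 0 < C by rewrite /C; lra.
pose theta := Num.min (e0 / 16) (Num.min (1 / 16) (e0 / (8 * C))).
have th0 : 0 < theta.
  by rewrite !lt_min; apply/and3P; split; [lra|lra|rewrite divr_gt0 //; lra].
have th1 : theta <= e0 / 16 by rewrite ge_min lexx.
have th2 : theta <= 1 / 16 by rewrite /theta ge_min ge_min lexx orbT.
have th3 : theta * (8 * C) <= e0.
  by rewrite -ler_pdivlMr ?ge_min ?lexx ?orbT //; lra.
clearbody theta.
have [e e_gt0 [down _]] := prod_close Fn2 F2 FnF X Y th0.
have clX := cubes_concentrate s0 cX hX e_gt0.
have clY := cubes_concentrate t0 cY hY e_gt0.
have dn : \forall n \near \oo, dconc (mmprod (Fn n) (Xs n) (Ys n)) (mmprod F X Y) < theta.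
  have /cvgrPdist_lt /(_ _ th0) := concXY; apply: filterS => n.
  by rewrite sub0r normrN ger0_norm ?dconc_ge0.
have Fst : \forall n \near \oo, `|Fn n s t - F s t| < e0 / 4.
  by apply: (near_cvgF FnF); lra.
have [n [[[dwn [clx cly]] [dcn Fnst]] bad]] :=
  freq _ (filterI (filterI down (filterI clX clY)) (filterI dn Fst)).
have [_ _ /(_ bad) Fbad] := stP n.
have [kappa hk] := square_map_exists R.
have [phi hphi] := has_law_exists (Xs n).
have [phi' hphi'] := has_law_exists (Ys n).
have [hpsi clphi] := clx phi hphi; have [hpsi' clphi'] := cly phi' hphi'.
have [Phi [Psi [hPhi hPsi _ up]]] := close_dconc (is_metric_mmprod (Xs n) (Ys n) (Fn2 n))
  (is_metric_mmprod X Y F2) (prod_parameter (Fn2 n) hk hphi hphi')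
  (prod_parameter F2 hk hpsi hpsi') dcn.
pose pr (z : cubeT (NX n).1.+1 * cubeT (NY n).1.+1) : Q := (z.1.1, z.2.1).
pose chi := pr \o Phi.
(* On opposite pairs the antipodal bound takes the place of [dF] and is smaller by at least e0 / 2.
   [D] need not be a metric; the coupling argument only asks that it be nonnegative. *)
pose D (q q' : Q) := if q' == (~~ q.1, ~~ q.2) then Fn n (st n).1 (st n).2 + 2 * theta
  else dF q q'.
have borel_n (B : set (md_T (mmprod (Fn n) (Xs n) (Ys n)))) :
    borel_d (@md_d _ (mmprod (Fn n) (Xs n) (Ys n))) B.
  apply: sub_sigma_algebra.
  apply: (@finite_metric_open R (cubeT (NX n).1.+1 * cubeT (NY n).1.+1)%type).
  exact: (is_metric_mmprod (Xs n) (Ys n) (Fn2 n)).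
have borel_lim (B : set Q) : borel_d dF B.
  by apply: sub_sigma_algebra; exact: finite_metric_open.
have st_ge0 : 0 <= (st n).1 /\ 0 <= (st n).2.
  by case: (stP n) => h1 h2 _; split; lra.
have Fn_ge0 : 0 <= Fn n (st n).1 (st n).2.
  by apply: mp_ge0; [exact: (Fn2 n).1|exact: st_ge0.1|exact: st_ge0.2].
have card4 : #|{: Q}| = 4%N by rewrite card_prod card_bool.
have step p : exists2 g : Q -> R, (forall q q', `|g q - g q'| <= D q q') &
    (lam (offby (2 * theta) (dF p \o Psi) (g \o chi)) <= (2 * theta)%:E)%E.
  have lp : @Lip1 _ (mmprod F X Y) (dF p) by move=> y z; exact: metric_lip mdF.
  (* Along [Phi] and [Psi], [f] approximates [dF p]. Along the product parameters [f] is nearly a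
     function [g] of the clusters; this is a statement about the measure of the product, so it can
     be read along [Phi] too. *)
  have [f lf hf] := up _ lp.
  have [g lg hg] := dwn _ _ _ _ _ _ hphi.1 hpsi clphi hphi'.1 hpsi' clphi' f lf.
  have PS : ((mm_P (Xs n) \x mm_P (Ys n))%E (offby theta f (g \o pr)) <= theta%:E)%E.
    have mS : @measurable _ (bspace (Xs n) * bspace (Ys n))%type (offby theta f (g \o pr)).
      exact: measurable_fin_prod.
    by rewrite -(prod_has_law hphi hphi' mS).
  exists g.
    move=> q q'; rewrite /D; case: eqP => [->|_]; last exact: lg.
    rewrite -(sX n) -(tY n).
    apply: (antipodal_bound (Fn2 n) lf _ PS); lra.
  apply: (@le_trans _ _ (lam (offby theta (f \o Phi) (dF p \o Psi) `|`
      Phi @^-1` (offby theta f (g \o pr))))).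
    apply: le_lam => u; rewrite /offby /= => hu; apply: contrapT => /not_orP[].
    move=> /negP; rewrite -leNgt => h1 /negP; rewrite -leNgt => h2.
    move: hu h1 h2; rewrite ltNge => /negP + h1 h2; apply.
    move: h1 h2; rewrite !ler_norml /chi /=.
    by move: (f _) (dF _ _) (g _) => *; lra.
  apply: (le_trans (lamU2 _ _)).
  have -> : 2 * theta = theta + theta by ring.
  rewrite EFinD; apply: leeD => //.
  by have [_ E] := hPhi _ (borel_n (offby theta f (g \o pr))); rewrite /lam E.
have := @uniform_coupling R Q dF D Psi chi (2 * theta) M.
rewrite card4 => cpl.
have : \sum_(P : Q * Q) dF P.1 P.2 <= \sum_(S : Q * Q) D S.1 S.2 +
    4%:R ^+ 2 * (2 * (2 * theta) + 4%:R ^+ 4 * (4%:R * (2 * theta) * M)).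
  apply: cpl => //.
  - by move=> p; have [] := hPsi _ (borel_lim [set p]).
  - by move=> q; have [] := hPhi _ (borel_n (pr @^-1` [set q])).
  - by move=> p; have [_ E] := hPsi _ (borel_lim [set p]); rewrite /lam E two_points_prod.
  - move=> q; have [_ E] := hPhi _ (borel_n (pr @^-1` [set q])); rewrite /lam E.
    exact: cubes_prod.
  - lra.
  - by move=> p; apply/dF0.
  - by move=> p q; rewrite /D; case: ifP => // _; lra.
have : \sum_(S : Q * Q) D S.1 S.2 <= \sum_(S : Q * Q) dF S.1 S.2 - e0 / 2.
  have dFst q : dF q (~~ q.1, ~~ q.2) = F s t.
    by rewrite /dF /=; case: q => [[] []] /=; rewrite !mulr1.
  have Dst : Fn n (st n).1 (st n).2 + 2 * theta <= F s t - e0 / 2.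
    by move: Fnst; rewrite ltr_norml; lra.
  pose S0 : Q * Q := ((true, true), (false, false)).
  have key S : D S.1 S.2 <= dF S.1 S.2 - (if S == S0 then e0 / 2 else 0).
    have [->|_] := eqVneq S S0; first by rewrite /D eqxx (dFst (true, true)).
    by rewrite subr0 /D; case: eqP => // ->; rewrite dFst; move: Dst; lra.
  apply: (le_trans (ler_sum _ (fun S _ => key S))).
  by rewrite sumrB -big_mkcond big_pred1_eq.
have -> : 4%:R ^+ 2 * (2 * (2 * theta) + 4%:R ^+ 4 * (4%:R * (2 * theta) * M)) =
  2 * (theta * C) :> R by rewrite /C; ring.
have th3' : 8 * (theta * C) <= e0 by rewrite mulrCA.
move: th3'.
move: (\sum_(S : Q * Q) D S.1 S.2) (\sum_(S : Q * Q) dF S.1 S.2) (theta * C) => a b z *.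
lra.
Qed.

(* Shifting both arguments by a small [r] reduces to positive [s], [t] and to
   strict inequalities. *)
Lemma upper_inf_cond_of_concentration : upper_inf_cond Fn.
Proof.
move=> s t s0 t0; apply/cvgrPdist_le => e e0.
have e80 : 0 < e / 8 by lra.
have [r r0 Fr] := F2_small F2 e80.
have sr : 0 < s + r by lra.
have tr : 0 < t + r by lra.
near=> n.
have hstrict : forall s' t', s + r < s' -> t + r < t' ->
    Fn n (s + r) (t + r) - e / 8 < Fn n s' t'.
  by near: n; exact: upper_inf_strict.
have hr : `|Fn n r r - F r r| < e / 8.
  by near: n; apply: (near_cvgF FnF); lra.
have r2 : 0 <= 2 * r <= 2 * r by rewrite lexx andbT; lra.
have h2r := mp_le_diag (Fn2 n).1 r2 r2.
have shift (a b d : R) : 0 <= a -> 0 <= b -> 0 <= d ->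
    `|Fn n a b - Fn n (a + d) (b + d)| <= Fn n d d.
  move=> a0 b0 d0; rewrite ler_norml.
  have a1 : 0 <= a + d by exact: addr_ge0.
  have b1 : 0 <= b + d by exact: addr_ge0.
  have := mp_perturb (Fn2 n).1 a0 b0 a1 b1; have := mp_perturb (Fn2 n).1 a1 b1 a0 b0.
  have E1 (z : R) : `|z - (z + d)| = d.
    by rewrite opprD addNKr normrN ger0_norm.
  have E2 (z : R) : `|z + d - z| = d by rewrite addrAC subrr add0r ger0_norm.
  rewrite !E1 !E2; move: (Fn n _ _) (Fn n _ _) (Fn n _ _) => *; lra.
rewrite sub0r normrN ger0_norm; last first.
  by rewrite subr_ge0; apply: upper_inf_le => //; exact: (Fn2 n).1.
rewrite lerBlDl -lerBlDr; apply: lb_le_inf.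
  by exists (Fn n s t); exists s => //=; exists t => //=.
move=> _ [s' /= ss' [t' /= tt' <-]].
have s0' : 0 <= s' by exact: le_trans ss'.
have t0' : 0 <= t' by exact: le_trans tt'.
(* Shifting by [r] on one side and [2 * r] on the other turns [s <= s'] into the strict
   [s + r < s' + 2 * r]. The costs are below e / 4 and e / 2, and [hstrict] adds e / 8. *)
have h1 := shift s t r s0 t0 (ltW r0).
have h2 := shift s' t' (2 * r) s0' t0' (proj1 (andP r2)).
have h3 : Fn n (s + r) (t + r) - e / 8 < Fn n (s' + 2 * r) (t' + 2 * r).
  by apply: hstrict; lra.
move: h1 h2 h3 hr h2r; rewrite !ler_norml !ltr_norml.
have Fr' := Fr.
move: (Fn n s t) (Fn n (s + r) _) (Fn n s' t') (Fn n (s' + 2 * r) _) (Fn n r r)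
  (Fn n (2 * r) _) (F r r) Fr' => *; lra.
Unshelve. all: end_near.
Qed.

End Necessity.

Theorem theorem1p1 (R : realType) (Fn : nat -> R -> R -> R) (F : R -> R -> R) :
  (forall n, in_F2 (Fn n)) -> in_F2 F ->
  (forall s t : R, 0 <= s -> 0 <= t -> (fun n => Fn n s t) @ \oo --> F s t) ->
  ((forall (Xs Ys : nat -> mmspace R) (X Y : mmspace R),
      concentrates (fun n => mm_data (Xs n)) (mm_data X) ->
      concentrates (fun n => mm_data (Ys n)) (mm_data Y) ->
      concentrates (fun n => mmprod (Fn n) (Xs n) (Ys n)) (mmprod F X Y))
   <->
   (forall s t : R, 0 <= s -> 0 <= t ->
      (fun n => Fn n s t - inf [set Fn n s' t' | s' in [set s' | s <= s'] & t' in [set t' | t <= t']])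
        @ \oo --> (0 : R))).
Proof.
move=> Fn2 F2 FnF; split=> [H1|H2 Xs Ys X Y].
  exact: (upper_inf_cond_of_concentration Fn2 F2 FnF H1).
exact: (prod_concentrates Fn2 F2 FnF).
Qed.
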